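(* For every integer $d\ge2$, the exact one-copy programming overhead of the family $\mathrm{Ad}_{\mathrm{SU}(d)}=\{X\mapsto UXU^\dagger: U\in \mathrm{SU}(d)\}$ of all $d$-dimensional unitary channels is $$\nu_1(\mathrm{Ad}_{\mathrm{SU}(d)})=d^2-1.$$
   Context: For a quantum channel (completely positive trace-preserving map) $\mathcal E$ on $\mathcal B(\mathbb C^d)$, the Choi operator is $J_{\mathcal E}=\sum_{i,j}|i\rangle\langle j|\otimes\mathcal E(|i\rangle\langle j|)$ and the program state is $\pi_{\mathcal E}=J_{\mathcal E}/d$ on $\mathbb C^d\otimes\mathbb C^d$. HPTP means linear, Hermiticity preserving and trace preserving. The diamond norm is $\|\mathcal P\|_\diamond=\sup_R\sup_{\|X\|_1\le1}\|(\mathrm{id}_R\otimes\mathcal P)(X)\|_1$ over finite-dimensional references $R$. For a nonempty set $\mathcal S$ of channels on $\mathcal B(\mathbb C^d)$, the exact one-copy programming overhead is $\nu_1(\mathcal S)=\min\|\mathcal P\|_\diamond$ over all HPTP maps $\mathcal P:\mathcal B(\mathbb C^d\otimes(\mathbb C^d\otimes\mathbb C^d))\to\mathcal B(\mathbb C^d)$ (independent of the target) such that $\mathcal P(\rho\otimes\pi_{\mathcal E})=\mathcal E(\rho)$ for all states $\rho$ on $\mathbb C^d$ and all $\mathcal E\in\mathcal S$. *)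

(* Defs.v *)
From HB Require Import structures.
From mathcomp Require Import all_boot all_order all_algebra.
From mathcomp Require Import spectral sesquilinear.
From mathcomp Require Import all_classical all_reals all_analysis.
From mathcomp Require Import complex.
From mathcomp Require mxtens.

Set Implicit Arguments.
Unset Strict Implicit.
Unset Printing Implicit Defensive.

Import Order.TTheory GRing.Theory Num.Theory.
Local Open Scope ring_scope.
Local Open Scope sesquilinear_scope.
Local Open Scope classical_set_scope.

(* Only the Kronecker product is taken from [mxtens], whose notation [A ^t k]
   for tensor powers clashes with the one of [sesquilinear] for adjoints.  The
   space C^m (x) C^n is C^(m * n), with |i>|k> at index [mxtens_index (i, k)]. *)
Notation "A *t B" := (mxtens.tensmx A B)
  (at level 40, left associativity, format "A  *t  B") : ring_scope.

Section Operators.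
Variable R : realType.
Local Notation C := R[i].

Definition psdmx n (A : 'M[C]_n) : Prop :=
  A \is hermsymmx /\ forall v : 'cV[C]_n, 0 <= (v ^t* *m A *m v) 0 0.

Definition is_state n (rho : 'M[C]_n) : Prop := psdmx rho /\ \tr rho = 1.

(* Square root by functional calculus on the eigenvalues; it is meaningful for
   positive semidefinite [A] only. *)
Definition sqrtmx n (A : 'M[C]_n) : 'M[C]_n :=
  invmx (spectralmx A) *m diag_mx (map_mx sqrtC (spectral_diag A))
    *m spectralmx A.

(* ||X||_1 = tr sqrt(X^dagger X); the trace is a nonnegative real, which [Re]
   brings back from [R[i]] to [R]. *)
Definition trace_norm n (X : 'M[C]_n) : R :=
  complex.Re (\tr (sqrtmx (X ^t* *m X))).

Definition mxtens_block r n (X : 'M[C]_(r * n)) (i j : 'I_r) : 'M[C]_n :=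
  \matrix_(k, l) X (mxtens.mxtens_index (i, k)) (mxtens.mxtens_index (j, l)).

(* (id_r (x) P)(X) = sum_(i,j) |i><j| (x) P(X_ij), where
   X = sum_(i,j) |i><j| (x) X_ij *)
Definition id_tens r n m (P : 'M[C]_n -> 'M[C]_m) (X : 'M[C]_(r * n)) :
    'M[C]_(r * m) :=
  \sum_(i < r) \sum_(j < r) delta_mx i j *t P (mxtens_block X i j).

Definition diamond_norm n m (P : 'M[C]_n -> 'M[C]_m) : \bar R :=
  ereal_sup [set t : \bar R | exists (r : nat) (X : 'M[C]_(r * n)),
    [/\ (0 < r)%N, trace_norm X <= 1 & t = (trace_norm (id_tens P X))%:E]].

Definition trace_preserving n m (P : 'M[C]_n -> 'M[C]_m) : Prop :=
  forall X, \tr (P X) = \tr X.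

Definition hermiticity_preserving n m (P : 'M[C]_n -> 'M[C]_m) : Prop :=
  forall X, X \is hermsymmx -> P X \is hermsymmx.

Definition completely_positive n m (P : 'M[C]_n -> 'M[C]_m) : Prop :=
  forall (r : nat) (X : 'M[C]_(r * n)),
    (0 < r)%N -> psdmx X -> psdmx (id_tens P X).

Record channel d := Channel {
  channel_map :> {linear 'M[C]_d -> 'M[C]_d};
  channel_cp : completely_positive channel_map;
  channel_tp : trace_preserving channel_map }.

Record hptp n m := Hptp {
  hptp_map :> {linear 'M[C]_n -> 'M[C]_m};
  hptp_hp : hermiticity_preserving hptp_map;
  hptp_tp : trace_preserving hptp_map }.

Definition choi d (E : 'M[C]_d -> 'M[C]_d) : 'M[C]_(d * d) :=
  \sum_(i < d) \sum_(j < d) delta_mx i j *t E (delta_mx i j).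

Definition program_state d (E : 'M[C]_d -> 'M[C]_d) : 'M[C]_(d * d) :=
  d%:R^-1 *: choi E.

Definition programs d (P : hptp (d * (d * d)) d) (S : set (channel d)) : Prop :=
  forall (rho : 'M[C]_d) (E : channel d), is_state rho -> S E ->
    P (rho *t program_state E) = E rho.

(* Values of the optimization problem; the overhead nu_1(S) is the minimum of
   this set, i.e. [nu1 S] below together with the attainment
   [nu1_values S (nu1 S)]. *)
Definition nu1_values d (S : set (channel d)) : set (\bar R) :=
  [set diamond_norm P | P in [set P : hptp (d * (d * d)) d | programs P S]].

Definition nu1 d (S : set (channel d)) : \bar R := ereal_inf (nu1_values S).

Lemma psdmx_conj n m (A : 'M[C]_n) (B : 'M[C]_(m, n)) :
  psdmx A -> psdmx (B *m A *m B ^t*).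
Proof.
case=> /is_hermitianmxP; rewrite expr0 scale1r => hA pA; split.
  apply/is_hermitianmxP; rewrite expr0 scale1r.
  by rewrite !trmx_mul !map_mxM -hA trmxCK mulmxA.
move=> v; have := pA (B ^t* *m v).
by rewrite trmx_mul map_mxM trmxCK !mulmxA.
Qed.

Section UnitaryChannel.
Variables (d : nat) (U : 'M[C]_d).

Definition adU (X : 'M[C]_d) : 'M[C]_d := U *m X *m U ^t*.

Fact adU_is_linear : linear adU.
Proof.
by move=> a X Y; rewrite /adU mulmxDr mulmxDl -scalemxAr -scalemxAl.
Qed.

HB.instance Definition _ :=
  GRing.isLinear.Build C 'M[C]_d 'M[C]_d *:%R adU adU_is_linear.

Lemma id_tens_adU r (X : 'M[C]_(r * d)) :
  id_tens adU X = (1%:M *t U) *m X *m (1%:M *t U) ^t*.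
Proof.
apply/matrixP => a b.
case: (mxtens.mxtens_indexP a) => i k; case: (mxtens.mxtens_indexP b) => j l.
have sumE (F : 'I_(r * d) -> C) :
    \sum_s F s = \sum_(p : 'I_r) \sum_(q : 'I_d) F (mxtens.mxtens_index (p, q)).
  rewrite pair_big /= (reindex (@mxtens.mxtens_index r d)) /=.
    by apply: eq_bigr => -[].
  by exists (@mxtens.mxtens_unindex r d) => s _;
    rewrite (mxtens.mxtens_indexK, mxtens.mxtens_unindexK).
transitivity (adU (mxtens_block X i j) k l).
  rewrite summxE (bigD1 i) //= [X in _ + X]big1 => [|i' i'i]; last first.
    rewrite summxE big1 // => j' _.
    by rewrite mxtens.tensmxE !mxE eq_sym (negPf i'i) mul0r.
  rewrite addr0 summxE (bigD1 j) //= [X in _ + X]big1 => [|j' j'j]; last first.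
    by rewrite mxtens.tensmxE !mxE eqxx [j == _]eq_sym (negPf j'j) mul0r.
  by rewrite addr0 mxtens.tensmxE mxE !eqxx mul1r.
have adjE p q : ((1%:M *t U) ^t* : 'M[C]_(r * d))
    (mxtens.mxtens_index (p, q)) (mxtens.mxtens_index (j, l)) =
    (j == p)%:R * (U ^t*) q l.
  by rewrite mxE [X in X^*]mxE mxtens.tensmxE mxE rmorphM rmorph_nat !mxE.
rewrite /adU [LHS]mxE [RHS]mxE sumE (bigD1 j) //=.
rewrite [X in _ = _ + X]big1 ?addr0 => [|p pj]; last first.
  by rewrite big1 // => q _; rewrite adjE eq_sym (negPf pj) mul0r mulr0.
apply: eq_bigr => q _; rewrite adjE eqxx mul1r; congr (_ * _).
rewrite [LHS]mxE [RHS]mxE sumE (bigD1 i) //=.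
rewrite [X in _ = _ + X]big1 ?addr0 => [|p pi]; last first.
  by rewrite big1 // => s _; rewrite mxtens.tensmxE mxE eq_sym (negPf pi) !mul0r.
by apply: eq_bigr => s _; rewrite mxtens.tensmxE !mxE eqxx mul1r.
Qed.

Lemma adU_cp : completely_positive adU.
Proof. by move=> r X _ pX; rewrite id_tens_adU; exact: psdmx_conj. Qed.

Lemma adU_tp : U \is unitarymx -> trace_preserving adU.
Proof.
move=> UU X; rewrite /adU mxtrace_mulC mulmxA.
by have /unitarymxP/mulmx1C-> := UU; rewrite mul1mx.
Qed.

Definition unitary_channel (UU : U \is unitarymx) : channel d :=
  Channel adU_cp (adU_tp UU).

End UnitaryChannel.

Definition AdSU d : set (channel d) :=
  [set E | exists (U : 'M[C]_d) (UU : U \is unitarymx),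
     \det U = 1 /\ E = unitary_channel UU].

End Operators.

Arguments AdSU : clear implicits.

(* Main.v *)
(** Write [Phi] for the maximally entangled state of the input [A] and the
    reference half [B] of the program, and [m = d^2 - 1].  Measuring
    [{Phi, 1 - Phi}] on [AB] leaves on the output half [C] the operators [bell X]
    and [cobell X]; on [X = rho (x) pi_U] they are [Y/d^2] and [1/d - Y/d^2] with
    [Y = U rho U^dagger].  Let [flip Y = (d tr(Y) 1 - Y)/m], which is completely
    positive and trace preserving.

    Upper bound: with [Y = U rho U^dagger] as above,
    [d^2/2 (bell X + flip (cobell X)) - (d^2-2)/2 (flip (bell X) + cobell X) = Y].
    Both brackets are channels, so the diamond norm of the left-hand side, as a
    map of [X], is at most [d^2/2 + (d^2-2)/2 = m].

    Lower bound: feed a feasible [P] with [Phi (x) Phi_CR] and with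
    [(1 - Phi)/m (x) Phi_CR], and test the outputs against [2 Phi - 1] and
    [1 - 2 Phi].  By trace preservation the two values add up to twice the
    difference of the two output fidelities with [Phi], which all feasible [P]
    share: the defect [P (rho (x) J(A,B)) - d A rho B], where
    [J(A,B) = sum_ij E_ij (x) A E_ij B], vanishes for [(A,B) = (U, U^dagger)],
    hence (elementary argument replacing the second-moment Haar integral) on a
    space of pairs large enough to determine that difference, namely [m]. *)
From HB Require Import structures.
Require Import Defs.
From mathcomp Require Import all_boot all_order all_algebra.
From mathcomp Require Import spectral sesquilinear.
From mathcomp Require Import all_classical all_reals all_analysis.
From mathcomp Require Import complex ring.
From mathcomp Require mxtens.
Set Implicit Arguments.
Unset Strict Implicit.
Unset Printing Implicit Defensive.
Import Order.TTheory GRing.Theory Num.Theory.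
Local Open Scope ring_scope.
Local Open Scope sesquilinear_scope.

(** * Adjoints, traces, contractions and matrix units *)

Section Adjoint.
Variable C : numClosedFieldType.

Lemma adjmxM m n p (A : 'M[C]_(m, n)) (B : 'M[C]_(n, p)) :
  (A *m B) ^t* = B ^t* *m A ^t*.
Proof. by rewrite trmx_mul map_mxM. Qed.

Lemma adjmxD m n (A B : 'M[C]_(m, n)) : (A + B) ^t* = A ^t* + B ^t*.
Proof. by rewrite linearD map_mxD. Qed.

Lemma adjmxN m n (A : 'M[C]_(m, n)) : (- A) ^t* = - A ^t*.
Proof. by rewrite linearN map_mxN. Qed.

Lemma adjmxZ m n a (A : 'M[C]_(m, n)) : (a *: A) ^t* = a^* *: A ^t*.
Proof. by rewrite linearZ map_mxZ. Qed.

Lemma adjmx1 n : (1%:M : 'M[C]_n) ^t* = 1%:M.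
Proof. by rewrite trmx1 map_mx1. Qed.

Lemma adjmx0 m n : (0 : 'M[C]_(m, n)) ^t* = 0.
Proof. by rewrite trmx0 map_mx0. Qed.

Lemma adjmx_sum m n (I : Type) (r : seq I) (P : pred I) (F : I -> 'M[C]_(m, n)) :
  (\sum_(i <- r | P i) F i) ^t* = \sum_(i <- r | P i) (F i) ^t*.
Proof. by rewrite linear_sum map_mx_sum. Qed.

Lemma adjmx_delta m n (i : 'I_m) (j : 'I_n) :
  (delta_mx i j : 'M[C]_(m, n)) ^t* = delta_mx j i.
Proof. by rewrite trmx_delta map_delta_mx. Qed.

Lemma mxtrace_adj n (A : 'M[C]_n) : \tr (A ^t*) = (\tr A)^*.
Proof.
by rewrite /mxtrace rmorph_sum; apply: eq_bigr => i _; rewrite !mxE.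
Qed.

Lemma mxtrace_mul_adjE m n (A : 'M[C]_(m, n)) :
  \tr (A *m A ^t*) = \sum_i \sum_j `|A i j| ^+ 2.
Proof.
rewrite /mxtrace; apply: eq_bigr => i _; rewrite !mxE.
by apply: eq_bigr => j _; rewrite !mxE normCK.
Qed.

Lemma mxtrace_mul_adj_ge0 m n (A : 'M[C]_(m, n)) : 0 <= \tr (A *m A ^t*).
Proof.
rewrite mxtrace_mul_adjE; apply: sumr_ge0 => i _; apply: sumr_ge0 => j _.
by rewrite exprn_ge0.
Qed.

Lemma mxtrace_mul_adj_eq0 m n (A : 'M[C]_(m, n)) :
  \tr (A *m A ^t*) = 0 -> A = 0.
Proof.
rewrite mxtrace_mul_adjE => A0; apply/matrixP => i j; rewrite mxE.
have ge0 k l : 0 <= `|A k l| ^+ 2 by rewrite exprn_ge0.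
have Ai := psumr_eq0P (fun i _ => sumr_ge0 _ (fun j _ => ge0 i j)) A0 (i := i) isT.
have /eqP := psumr_eq0P (fun j _ => ge0 i j) Ai (i := j) isT.
by rewrite expf_eq0 /= normr_eq0 => /eqP.
Qed.

Lemma adj_mul_eq0 m n (A : 'M[C]_(m, n)) : A ^t* *m A = 0 -> A = 0.
Proof.
by move=> A0; apply: mxtrace_mul_adj_eq0; rewrite mxtrace_mulC A0 linear0.
Qed.

Lemma hermsymmxE n (A : 'M[C]_n) : A \is hermsymmx <-> A ^t* = A.
Proof.
split; first by move/is_hermitianmxP; rewrite expr0 scale1r => <-.
by move=> AE; apply/is_hermitianmxP; rewrite expr0 scale1r AE.
Qed.

(** This is [W W^dagger <= 1] in the positive semidefinite order, tested on blocks of columns [Z] as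
    they occur in trace inequalities. *)
Definition contraction_mx m n (W : 'M[C]_(m, n)) : Prop :=
  forall p (Z : 'M[C]_(m, p)),
    \tr (Z ^t* *m (W *m W ^t*) *m Z) <= \tr (Z ^t* *m Z).

Lemma contraction_mx_isometry m n (W : 'M[C]_(m, n)) :
  W *m W ^t* = 1%:M -> contraction_mx W.
Proof. by move=> WW p Z; rewrite WW mulmx1. Qed.

(** Expand [tr (D D^dagger) >= 0] for [D = A - W^dagger B] and bound the term quadratic in [B] by
    contractivity. *)
Lemma contraction_mx_cauchy_schwarz m n p (W : 'M[C]_(m, n))
    (A : 'M[C]_(n, p)) (B : 'M[C]_(m, p)) : contraction_mx W ->
  \tr (W *m (A *m B ^t*)) + (\tr (W *m (A *m B ^t*)))^* <=
  \tr (A *m A ^t*) + \tr (B *m B ^t*).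
Proof.
move=> cW; have := mxtrace_mul_adj_ge0 (A - W ^t* *m B).
have := cW _ B.
rewrite adjmxD adjmxN adjmxM trmxCK mulmxDl !mulmxDr !mulNmx !mulmxN opprK.
rewrite !mxtraceD ![\tr (- _)]linearN /= -mxtrace_adj !adjmxM trmxCK !mulmxA.
have -> : \tr (B^t* *m W *m W^t* *m B) = \tr (W^t* *m B *m B^t* *m W).
  by rewrite -mulmxA mxtrace_mulC !mulmxA.
have -> : \tr (B^t* *m B) = \tr (B *m B^t*) by rewrite mxtrace_mulC.
have -> : \tr (W *m A *m B^t*) = \tr (A *m B^t* *m W).
  by rewrite [RHS]mxtrace_mulC mulmxA.
have -> : \tr (B *m A^t* *m W^t*) = \tr (W^t* *m B *m A^t*).
  by rewrite [LHS]mxtrace_mulC mulmxA.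
move=> cB h; rewrite -subr_ge0; apply: (le_trans h); rewrite -subr_ge0 in cB.
rewrite -subr_ge0 (_ : _ - _ = \tr (B *m B^t*) - \tr (W^t* *m B *m B^t* *m W)) //.
ring.
Qed.

Lemma sum_delta_diag n : \sum_(i < n) delta_mx i i = 1%:M :> 'M[C]_n.
Proof.
apply/matrixP => i j; rewrite summxE (bigD1 i) //= big1 => [|c ci].
  by rewrite !mxE eqxx addr0 eq_sym.
by rewrite mxE eq_sym (negPf ci).
Qed.

Lemma mxtrace_delta_mul n (k l : 'I_n) (M : 'M[C]_n) : \tr (delta_mx k l *m M) = M l k.
Proof.
rewrite /mxtrace (bigD1 k) //= big1 => [|i ik].
  rewrite mxE (bigD1 l) //= big1 => [|j jl]; last by rewrite mxE (negPf jl) andbF mul0r.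
  by rewrite mxE !eqxx mul1r !addr0.
by rewrite mxE big1 // => j _; rewrite mxE (negPf ik) mul0r.
Qed.

Lemma mxtrace_delta n (k l : 'I_n) : \tr (delta_mx k l : 'M[C]_n) = (k == l)%:R.
Proof. by rewrite -[delta_mx k l]mulmx1 mxtrace_delta_mul mxE eq_sym. Qed.

Lemma delta_sandwich d (rho : 'M[C]_d) (k a b l : 'I_d) :
  delta_mx k a *m rho *m delta_mx b l = rho a b *: delta_mx k l.
Proof.
apply/matrixP => i j; rewrite !mxE (bigD1 b) //= big1 => [|c cb]; last first.
  by rewrite !mxE (negPf cb) mulr0.
rewrite !mxE (bigD1 a) //= big1 => [|c ca]; last by rewrite mxE (negPf ca) andbF mul0r.
by rewrite !mxE !eqxx !addr0 andbT; case: (i == k); case: (j == l); rewrite /=; ring.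
Qed.

Lemma sum_diag (V : nmodType) n (F : 'I_n -> 'I_n -> V) :
  \sum_i \sum_j (if i == j then F i j else 0) = \sum_i F i i.
Proof.
apply: eq_bigr => i _; rewrite (bigD1 i) //= eqxx big1 ?addr0 // => j ji.
by rewrite eq_sym (negPf ji).
Qed.

End Adjoint.

(** * Polar decomposition adapted to the trace norm *)

Section TraceNorm.
Variable R : realType.
Local Notation C := R[i].

(** Diagonalize [X^dagger X = S^dagger s S] and put [V = X S^dagger]. Then
    [W = S^dagger s^(-1/2) V^dagger] is the adjoint of the polar partial isometry, and the balanced
    choice [A = V s^(-1/4)], [B = S^dagger s^(1/4)] gives both factors the squared Hilbert-Schmidt
    norm [||X||_1]. *)
Lemma polar_decomposition n (X : 'M[C]_n) : exists (W A B : 'M[C]_n),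
  [/\ X = A *m B ^t*, contraction_mx W,
      \tr (W *m X) = (trace_norm X)%:C%C,
      \tr (A *m A ^t*) = (trace_norm X)%:C%C &
      \tr (B *m B ^t*) = (trace_norm X)%:C%C].
Proof.
set H := X ^t* *m X.
have Hn : H \is normalmx.
  by apply/hermitian_normalmx/hermsymmxE; rewrite /H adjmxM trmxCK.
set S := spectralmx H; set s := spectral_diag H.
have SU : S \is unitarymx by exact: spectral_unitarymx.
have SV : invmx S = S ^t* by exact: invmx_unitary.
have SS : S *m S ^t* = 1%:M by apply/unitarymxP.
have SS' : S ^t* *m S = 1%:M by apply: mulmx1C.
have HE : H = S ^t* *m diag_mx s *m S by rewrite -SV; apply/orthomx_spectralP.
have DE : S *m H *m S ^t* = diag_mx s.
  by rewrite HE !mulmxA SS mul1mx -mulmxA SS mulmx1.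
have s_ge0 i : 0 <= s 0 i.
  have <- : (diag_mx s) i i = s 0 i by rewrite mxE eqxx.
  rewrite -DE /H !mulmxA -[S *m X^t*]trmxCK adjmxM trmxCK -mulmxA mxE.
  by apply: sumr_ge0 => k _; rewrite !mxE mulrC -normCK exprn_ge0.
pose diagf (f : C -> C) := diag_mx (map_mx f s).
have diagM f g : diagf f *m diagf g = diagf (fun x => f x * g x).
  by rewrite mulmx_diag; congr diag_mx; apply/rowP => i; rewrite !mxE.
have tr_diag f : \tr (diagf f) = \sum_i f (s 0 i).
  by rewrite mxtrace_diag; apply: eq_bigr => i _; rewrite mxE.
have adj_diag (f : C -> C) : (forall x, 0 <= x -> 0 <= f x) ->
    (diagf f) ^t* = diagf f.
  move=> f0; rewrite tr_diag_mx map_diag_mx; congr diag_mx.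
  by apply/rowP => i; rewrite !mxE; apply: (geC0_conj (f0 _ (s_ge0 i))).
have eq_diag f g : (forall x, 0 <= x -> f x = g x) -> diagf f = diagf g.
  by move=> fg; congr diag_mx; apply/rowP => i; rewrite !mxE fg.
have sE : diag_mx s = diagf id by congr diag_mx; apply/rowP => i; rewrite !mxE.
(* Square root, fourth root and inverse square root; as [0^-1 = 0], [e] is a pseudo-inverse and
   [r x * e x] is the indicator of [x != 0]. *)
pose r x : C := sqrtC x; pose q x : C := sqrtC (sqrtC x).
pose e x : C := (sqrtC x)^-1.
have r0 x : 0 <= x -> 0 <= r x by rewrite /r sqrtC_ge0.
have q0 x : 0 <= x -> 0 <= q x by move=> x0; rewrite /q sqrtC_ge0 r0.
have e0 x : 0 <= x -> 0 <= e x by move=> x0; rewrite /e invr_ge0 r0.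
have rr x : r x * r x = x by rewrite -expr2 sqrtCK.
have qq x : q x * q x = r x by rewrite -expr2 sqrtCK.
have re x : r x * e x = (x != 0)%:R.
  rewrite /r /e; have [->|x0] := eqVneq x 0; first by rewrite sqrtC0 mul0r.
  by rewrite divff // sqrtC_eq0.
have trE : \tr (sqrtmx H) = \sum_i r (s 0 i).
  by rewrite /sqrtmx mxtrace_mulC mulmxA mulmxV ?mul1mx ?tr_diag ?spectral_unit.
have normE : (trace_norm X)%:C%C = \sum_i r (s 0 i).
  rewrite /trace_norm -/H trE; apply: RRe_real.
  by apply: ger0_real; apply: sumr_ge0 => i _; apply: r0.
set V := X *m S ^t*.
have VV : V ^t* *m V = diagf id by rewrite -sE -DE /V adjmxM trmxCK /H !mulmxA.
have XE : X = V *m S by rewrite /V -mulmxA SS' mulmx1.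
clearbody V; have er0 x : 0 <= x -> 0 <= e x * q x by move=> x0; rewrite mulr_ge0 ?e0 ?q0.
have eqq x : e x * q x * q x = r x * e x by rewrite -mulrA qq mulrC.
have exr x : e x * x = r x.
  rewrite /e /r -{2}[x]rr /r mulrA; have [->|x0] := eqVneq x 0.
    by rewrite sqrtC0 mulr0.
  by rewrite mulVf ?mul1r // sqrtC_eq0.
(* The columns of [V] at zero eigenvalues vanish, since [V^dagger V = diag s]; cutting to the
   support therefore changes nothing. *)
have VE : V = V *m diagf (fun x => r x * e x).
  apply/eqP; rewrite -subr_eq0; apply/eqP; apply: adj_mul_eq0.
  rewrite -[X in X - _]mulmx1 -mulmxBr adjmxM -mulmxA [V^t* *m _]mulmxA VV.
  rewrite mulmxBr mulmx1 diagM (_ : diagf _ - _ = 0) ?mulmx0 //.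
  apply/eqP; rewrite subr_eq0; apply/eqP; apply: eq_diag => x _.
  by rewrite mulrC -mulrA exr rr.
exists (S ^t* *m diagf e *m V ^t*), (V *m diagf (fun x => e x * q x)),
  (S ^t* *m diagf q).
split.
- rewrite adjmxM trmxCK adj_diag // mulmxA -(mulmxA V) diagM.
  by rewrite (@eq_diag _ _ (fun x _ => eqq x)) -VE.
- move=> p Z; rewrite !adjmxM !trmxCK adj_diag //.
  have -> : S^t* *m diagf e *m V^t* *m (V *m (diagf e *m S)) =
            S^t* *m diagf (fun x => (x != 0)%:R) *m S.
    rewrite -!mulmxA (mulmxA (V^t*)) VV (mulmxA (diagf id)) diagM.
    rewrite (mulmxA (diagf e)) diagM.
    rewrite (@eq_diag _ (fun x => (x != 0)%:R)) ?mulmxA // => x _.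
    by rewrite mulrA exr re.
  rewrite !mulmxA -(mulmxA _ S) -[Z^t* *m S^t*]adjmxM.
  have -> : Z^t* *m Z = (S *m Z)^t* *m (S *m Z).
    by rewrite adjmxM -mulmxA (mulmxA (S^t*)) SS' mul1mx.
  rewrite -mulmxA mxtrace_mulC [leRHS]mxtrace_mulC /mxtrace.
  apply: ler_sum => i _; rewrite -mulmxA /diagf mul_diag_mx !mxE.
  case: eqP => _; rewrite ?mul0r ?mul1r //.
  by apply: sumr_ge0 => j _; rewrite !mxE -normCK exprn_ge0.
- rewrite normE -tr_diag {1}XE -!mulmxA mxtrace_mulC -!mulmxA (mulmxA (V^t*)).
  rewrite VV SS mulmx1 diagM; congr (\tr _); apply: eq_diag => x _; exact: exr.
- rewrite normE -tr_diag mxtrace_mulC adjmxM adj_diag // -mulmxA.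
  rewrite (mulmxA (V^t*)) VV !diagM; congr (\tr _); apply: eq_diag => x _.
  rewrite (_ : _ * _ = (e x * x) * (e x * q x * q x)); last by ring.
  by rewrite exr eqq mulrA rr mulrC exr.
- rewrite normE -tr_diag mxtrace_mulC adjmxM trmxCK adj_diag // -mulmxA.
  by rewrite (mulmxA S) SS mul1mx diagM; congr (\tr _); apply: eq_diag => x _.
Qed.
End TraceNorm.

(** * Trace norm bounds by factorization and by duality *)

Section TraceNormBounds.
Variable R : realType.
Local Notation C := R[i].

(** Test the sum against its own polar contraction [W], which attains the norm, and apply
    Cauchy-Schwarz to each term. *)
Lemma trace_norm_sum_le (I : Type) (s : seq I) n p (A B : I -> 'M[C]_(n, p)) :
  (trace_norm (\sum_(i <- s) A i *m (B i) ^t*) *+ 2)%:C%C <=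
  \sum_(i <- s) (\tr (A i *m (A i) ^t*) + \tr (B i *m (B i) ^t*)).
Proof.
set X := (X in trace_norm X).
have [W [_ [_ [_ cW WX _ _]]]] := polar_decomposition X.
have -> : (trace_norm X *+ 2)%:C%C = \tr (W *m X) + (\tr (W *m X))^*.
  rewrite WX geC0_conj ?mulr2n ?rmorphD //.
  have [_ [A' [_ [_ _ _ <- _]]]] := polar_decomposition X.
  exact: mxtrace_mul_adj_ge0.
rewrite /X mulmx_sumr linear_sum rmorph_sum -big_split /=.
by apply: ler_sum => i _; apply: contraction_mx_cauchy_schwarz.
Qed.

(** The balanced factorization of [X] makes both squares in Cauchy-Schwarz equal to [||X||_1]. *)
Lemma trace_norm_ge_isometry n (W X : 'M[C]_n) : W *m W ^t* = 1%:M ->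
  \tr (W *m X) + (\tr (W *m X))^* <= (trace_norm X *+ 2)%:C%C.
Proof.
move=> WW; have [_ [A [B [XE _ _ tA tB]]]] := polar_decomposition X.
rewrite {1 2}XE rmorphMn /= mulr2n -{1}tA -tB.
exact/contraction_mx_cauchy_schwarz/contraction_mx_isometry.
Qed.

Lemma trace_norm_sum_adj_le (I : Type) (s : seq I) n p (A : I -> 'M[C]_(n, p)) :
  (trace_norm (\sum_(i <- s) A i *m (A i) ^t*))%:C%C <=
  \tr (\sum_(i <- s) A i *m (A i) ^t*).
Proof.
have := trace_norm_sum_le s A A.
by rewrite rmorphMn big_split /= -mulr2n lerMn2r -linear_sum.
Qed.

End TraceNormBounds.

(** * Kronecker products *)

Section Tensor.
Variable C : numClosedFieldType.

Lemma sum_mxtens_index (V : nmodType) m n (F : 'I_(m * n) -> V) :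
  \sum_s F s = \sum_i \sum_j F (mxtens.mxtens_index (i, j)).
Proof.
rewrite pair_big /= (reindex (@mxtens.mxtens_index m n)) /=.
  by apply: eq_bigr => -[].
by exists (@mxtens.mxtens_unindex m n) => s _;
  rewrite (mxtens.mxtens_indexK, mxtens.mxtens_unindexK).
Qed.

Lemma mxtrace_tens m n (A : 'M[C]_m) (B : 'M[C]_n) : \tr (A *t B) = \tr A * \tr B.
Proof.
rewrite /mxtrace sum_mxtens_index big_distrl; apply: eq_bigr => i _ /=.
by rewrite big_distrr; apply: eq_bigr => j _ /=; rewrite mxtens.tensmxE.
Qed.

Lemma adjmx_tens m n p q (A : 'M[C]_(m, n)) (B : 'M[C]_(p, q)) :
  (A *t B) ^t* = A ^t* *t B ^t*.
Proof. by rewrite mxtens.trmx_tens mxtens.map_mxT. Qed.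

Lemma tensmxDl m n p q (A A' : 'M[C]_(m, n)) (B : 'M[C]_(p, q)) :
  (A + A') *t B = A *t B + A' *t B.
Proof. by apply/matrixP => i j; rewrite !mxE mulrDl. Qed.

Lemma tensmxDr m n p q (A : 'M[C]_(m, n)) (B B' : 'M[C]_(p, q)) :
  A *t (B + B') = A *t B + A *t B'.
Proof. by apply/matrixP => i j; rewrite !mxE mulrDr. Qed.

Lemma tensmxZl m n p q a (A : 'M[C]_(m, n)) (B : 'M[C]_(p, q)) :
  (a *: A) *t B = a *: (A *t B).
Proof. by apply/matrixP => i j; rewrite !mxE mulrA. Qed.

Lemma tensmxZr m n p q a (A : 'M[C]_(m, n)) (B : 'M[C]_(p, q)) :
  A *t (a *: B) = a *: (A *t B).
Proof. by apply/matrixP => i j; rewrite !mxE mulrCA. Qed.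

Lemma tensmx_sumr (I : Type) (r : seq I) (P : pred I) m n p q
    (A : 'M[C]_(m, n)) (F : I -> 'M[C]_(p, q)) :
  A *t (\sum_(i <- r | P i) F i) = \sum_(i <- r | P i) A *t F i.
Proof.
by apply: (big_morph (fun B => A *t B)) => [B B'|]; rewrite ?tensmxDr ?mxtens.tensmx0.
Qed.
End Tensor.

(** * Ampliations, Kraus maps and the diamond norm upper bound *)

Section IdTens.
Variable R : realType.
Local Notation C := R[i].

Lemma mxtens_block_sum r n (G : 'I_r -> 'I_r -> 'M[C]_n) i j :
  mxtens_block (\sum_k \sum_l delta_mx k l *t G k l) i j = G i j.
Proof.
apply/matrixP => a b; rewrite mxE summxE (bigD1 i) //= [X in _ + X]big1 => [|k ki].
  rewrite addr0 summxE (bigD1 j) //= [X in _ + X]big1 => [|l lj].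
    by rewrite mxtens.tensmxE mxE !eqxx mul1r addr0.
  by rewrite mxtens.tensmxE mxE [j == l]eq_sym (negPf lj) andbF mul0r.
rewrite summxE big1 // => l _.
by rewrite mxtens.tensmxE mxE [i == k]eq_sym (negPf ki) mul0r.
Qed.

Lemma mxtens_block_decomp r n (X : 'M[C]_(r * n)) :
  X = \sum_i \sum_j delta_mx i j *t mxtens_block X i j.
Proof.
apply/matrixP => a b.
case: (mxtens.mxtens_indexP a) => i k; case: (mxtens.mxtens_indexP b) => j l.
transitivity (mxtens_block X i j k l); first by rewrite mxE.
by rewrite -(mxtens_block_sum (mxtens_block X) i j) mxE.
Qed.

Lemma id_tensE r n m (P : 'M[C]_n -> 'M[C]_m) (G : 'I_r -> 'I_r -> 'M[C]_n) :
  id_tens P (\sum_k \sum_l delta_mx k l *t G k l) =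
  \sum_k \sum_l delta_mx k l *t P (G k l).
Proof.
by apply: eq_bigr => k _; apply: eq_bigr => l _; rewrite mxtens_block_sum.
Qed.

Lemma mxtrace_id_tens r n m c (P : 'M[C]_n -> 'M[C]_m) (X : 'M[C]_(r * n)) :
  (forall Y, \tr (P Y) = c * \tr Y) -> \tr (id_tens P X) = c * \tr X.
Proof.
move=> trP; rewrite [in RHS](mxtens_block_decomp X) /id_tens.
rewrite !linear_sum big_distrr; apply: eq_bigr => i _ /=.
rewrite !linear_sum big_distrr; apply: eq_bigr => j _ /=.
by rewrite !mxtrace_tens trP mulrCA.
Qed.

Lemma id_tens_sandwich r n m (K : 'M[C]_(m, n)) (X : 'M[C]_(r * n)) :
  id_tens (fun Y => K *m Y *m K ^t*) X = (1%:M *t K) *m X *m (1%:M *t K) ^t*.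
Proof.
rewrite [in RHS](mxtens_block_decomp X) /id_tens mulmx_sumr mulmx_suml.
apply: eq_bigr => i _; rewrite mulmx_sumr mulmx_suml; apply: eq_bigr => j _.
by rewrite adjmx_tens !mxtens.tensmx_mul adjmx1 mul1mx mulmx1.
Qed.

(** Complete positivity in Kraus form: it passes to sums, nonnegative multiples, compositions and
    ampliations by manipulating lists of operators. *)
Definition kraus n m (P : 'M[C]_n -> 'M[C]_m) : Prop :=
  exists s : seq 'M[C]_(m, n), forall X, P X = \sum_(K <- s) K *m X *m K ^t*.

Lemma kraus_sandwich n m (K : 'M[C]_(m, n)) : kraus (fun X => K *m X *m K ^t*).
Proof. by exists [:: K] => X; rewrite big_seq1. Qed.

Lemma krausD n m (P Q : 'M[C]_n -> 'M[C]_m) :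
  kraus P -> kraus Q -> kraus (fun X => P X + Q X).
Proof.
by move=> [s sE] [t tE]; exists (s ++ t) => X; rewrite big_cat sE tE.
Qed.

Lemma kraus_sum (I : Type) (r : seq I) n m (P : I -> 'M[C]_n -> 'M[C]_m) :
  (forall i, kraus (P i)) -> kraus (fun X => \sum_(i <- r) P i X).
Proof.
move=> kP; elim: r => [|i r [s sE]]; first by exists [::] => X; rewrite !big_nil.
have [t tE] := kP i.
by exists (t ++ s) => X; rewrite big_cat big_cons -sE -tE.
Qed.

Lemma krausZ n m a (P : 'M[C]_n -> 'M[C]_m) :
  0 <= a -> kraus P -> kraus (fun X => a *: P X).
Proof.
move=> a0 [s sE]; exists [seq sqrtC a *: K | K <- s] => X.
rewrite big_map sE scaler_sumr; apply: eq_bigr => K _.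
rewrite adjmxZ -scalemxAl -scalemxAr -scalemxAl scalerA.
by rewrite geC0_conj ?sqrtC_ge0 // -expr2 sqrtCK.
Qed.

Lemma kraus_comp n m p (P : 'M[C]_n -> 'M[C]_m) (Q : 'M[C]_m -> 'M[C]_p) :
  kraus P -> kraus Q -> kraus (fun X => Q (P X)).
Proof.
move=> [s sE] [t tE]; exists [seq L *m K | L <- t, K <- s] => X.
rewrite big_allpairs_dep tE sE; apply: eq_bigr => L _.
rewrite mulmx_sumr mulmx_suml; apply: eq_bigr => K _.
by rewrite adjmxM !mulmxA.
Qed.

Lemma kraus_adj n m (P : 'M[C]_n -> 'M[C]_m) X :
  kraus P -> P (X ^t*) = (P X) ^t*.
Proof.
move=> [s sE]; rewrite !sE adjmx_sum; apply: eq_bigr => K _.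
by rewrite !adjmxM trmxCK mulmxA.
Qed.

Lemma kraus_linear n m (P : 'M[C]_n -> 'M[C]_m) : kraus P -> linear P.
Proof.
move=> [s sE] a X Y; rewrite !sE scaler_sumr -big_split /=.
by apply: eq_bigr => K _; rewrite mulmxDr mulmxDl -scalemxAr -scalemxAl.
Qed.

Lemma kraus_id_tens r n m (P : 'M[C]_n -> 'M[C]_m) :
  kraus P -> kraus (@id_tens _ r _ _ P).
Proof.
move=> [s sE]; exists [seq (1%:M : 'M[C]_r) *t K | K <- s] => X.
rewrite big_map.
under [RHS]eq_bigr do rewrite -id_tens_sandwich.
rewrite /id_tens [RHS]exchange_big; apply: eq_bigr => i _ /=.
rewrite [RHS]exchange_big; apply: eq_bigr => j _ /=.
by rewrite sE tensmx_sumr.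
Qed.

(** With [X = A B^dagger] balanced, the output is a sum of terms [(K A) (K B)^dagger], where the
    operators of [Q] carry a sign on the left factor only. The sign disappears in the squares, whose
    sums are governed by [P + Q] and equal [c ||X||_1] each. *)
Lemma diamond_norm_kraus_diff n m (c : R) (P Q : 'M[C]_n -> 'M[C]_m) :
  0 <= c -> kraus P -> kraus Q ->
  (forall X, \tr (P X) + \tr (Q X) = c%:C%C * \tr X) ->
  (diamond_norm (fun X => (P X - Q X)%R) <= c%:E)%E.
Proof.
move=> c0 kP kQ trPQ; apply: ge_ereal_sup => _ [r [X [r0 X1 ->]]]; rewrite lee_fin.
have [s sE] := kraus_id_tens r kP; have [t tE] := kraus_id_tens r kQ.
have [_ [A [B [XE _ _ tA tB]]]] := polar_decomposition X.
pose S := [seq (K, K) | K <- s] ++ [seq (- K, K) | K <- t].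
have YE : id_tens (fun X => P X - Q X) X =
    \sum_(K <- S) (K.1 *m A) *m (K.2 *m B)^t*.
  rewrite big_cat !big_map /=.
  under eq_bigr do rewrite adjmxM mulmxA -(mulmxA _ A) -XE.
  under [X in _ + X]eq_bigr do
    rewrite adjmxM mulmxA -(mulmxA _ A) -XE !mulNmx.
  rewrite sumrN -sE -tE /id_tens -sumrB; apply: eq_bigr => i _.
  rewrite -sumrB; apply: eq_bigr => j _.
  by apply/matrixP => a b; rewrite !mxE mulrBr.
have trS Z : \sum_(K <- S) \tr (K.2 *m Z *m (K.2)^t*) = c%:C%C * \tr Z.
  rewrite big_cat !big_map /= -!linear_sum /= -sE -tE.
  rewrite [in RHS](mxtens_block_decomp Z) /id_tens !linear_sum -big_split mulr_sumr.
  apply: eq_bigr => i _ /=; rewrite !linear_sum -big_split mulr_sumr.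
  by apply: eq_bigr => j _ /=; rewrite !mxtrace_tens -mulrDr trPQ mulrCA.
have := trace_norm_sum_le S (fun K => K.1 *m A) (fun K => K.2 *m B).
rewrite -YE big_split /=.
have -> : \sum_(K <- S) \tr (K.1 *m A *m (K.1 *m A)^t*) = (c * trace_norm X)%:C%C.
  rewrite rmorphM /= -tA -trS !big_cat !big_map /=; congr (_ + _);
  apply: eq_bigr => K _; rewrite adjmxM !mulmxA // adjmxN !mulNmx mulmxN opprK //.
have -> : \sum_(K <- S) \tr (K.2 *m B *m (K.2 *m B)^t*) = (c * trace_norm X)%:C%C.
  by rewrite rmorphM /= -tB -trS; apply: eq_bigr => K _; rewrite adjmxM !mulmxA.
rewrite -rmorphD lecR -mulr2n lerMn2r /= => /le_trans; apply.
by rewrite ler_piMr.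
Qed.

End IdTens.

(** * Bilinear forms that vanish on all pairs [(U, U^dagger)] *)

Section BilinearForms.
Variable C : numClosedFieldType.

Definition bilin (U V : lmodType C) (f : U -> V -> C) : Prop :=
  (forall v, scalar (fun u => f u v)) /\ (forall u, scalar (f u)).

Section BilinTheory.
Variables (U V : lmodType C) (f : U -> V -> C).
Hypothesis bf : bilin f.

Lemma bilinDl u u' v : f (u + u') v = f u v + f u' v.
Proof. by have := bf.1 v 1 u u'; rewrite scale1r mul1r. Qed.

Lemma bilinDr u v v' : f u (v + v') = f u v + f u v'.
Proof. by have := bf.2 u 1 v v'; rewrite scale1r mul1r. Qed.

Lemma bilin0l v : f 0 v = 0.
Proof. by apply: (addrI (f 0 v)); rewrite -bilinDl !addr0. Qed.

Lemma bilin0r u : f u 0 = 0.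
Proof. by apply: (addrI (f u 0)); rewrite -bilinDr !addr0. Qed.

Lemma bilinZl a u v : f (a *: u) v = a * f u v.
Proof. by have := bf.1 v a u 0; rewrite !addr0 bilin0l addr0. Qed.

Lemma bilinZr a u v : f u (a *: v) = a * f u v.
Proof. by have := bf.2 u a v 0; rewrite !addr0 bilin0r addr0. Qed.

Lemma bilinNr u v : f u (- v) = - f u v.
Proof. by rewrite -scaleN1r bilinZr mulN1r. Qed.

Lemma bilin_suml (I : Type) (r : seq I) (F : I -> U) v :
  f (\sum_(i <- r) F i) v = \sum_(i <- r) f (F i) v.
Proof. exact: (big_morph (f^~ v) (fun u u' => bilinDl u u' v) (bilin0l v)). Qed.

Lemma bilin_sumr (I : Type) (r : seq I) (F : I -> V) u :
  f u (\sum_(i <- r) F i) = \sum_(i <- r) f u (F i).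
Proof. exact: (big_morph (f u) (bilinDr u) (bilin0r u)). Qed.
End BilinTheory.

Lemma bilin_comp (U V U' V' : lmodType C) (f : U -> V -> C)
    (g : U' -> U) (h : V' -> V) : bilin f -> linear g -> linear h ->
  bilin (fun u v => f (g u) (h v)).
Proof.
move=> bf lg lh; split=> [v a u u'|u a v v'] /=.
  by rewrite lg (bilinDl bf) (bilinZl bf).
by rewrite lh (bilinDr bf) (bilinZr bf).
Qed.

Lemma linear_mulmxl m n p (A : 'M[C]_(m, n)) :
  linear (fun B : 'M[C]_(n, p) => A *m B).
Proof. by move=> a B B'; rewrite mulmxDr scalemxAr. Qed.

Lemma linear_mulmxr m n p (A : 'M[C]_(n, p)) :
  linear (fun B : 'M[C]_(m, n) => B *m A).
Proof. by move=> a B B'; rewrite mulmxDl scalemxAl. Qed.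

Lemma linear_sandwich m n p q (A : 'M[C]_(m, n)) (B : 'M[C]_(p, q)) :
  linear (fun M : 'M[C]_(n, p) => A *m M *m B).
Proof. by move=> a M M'; rewrite mulmxDr mulmxDl -scalemxAr -scalemxAl. Qed.

(** Such a form is a multiple of the pairing [w u]; the multiple is written as the mean of the
    diagonal values, an explicit expression in [q]. *)
Lemma bilin_orthogonal n (q : 'cV[C]_n -> 'rV[C]_n -> C) : (0 < n)%N -> bilin q ->
  (forall u w, w *m u = 0 -> q u w = 0) -> forall k l,
  q (delta_mx k 0) (delta_mx 0 l) =
  (k == l)%:R * (n%:R^-1 * \sum_m q (delta_mx m 0) (delta_mx 0 m)).
Proof.
move=> n0 bq q0 k l; have [<-|kl] := eqVneq k l; last first.
  by rewrite mul0r q0 // mul_delta_mx_0 // eq_sym.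
rewrite mul1r (eq_bigr (fun=> q (delta_mx k 0) (delta_mx 0 k))) => [|m _].
  by rewrite sumr_const card_ord -[X in _ * X]mulr_natl mulKf // pnatr_eq0 -lt0n.
have [->//|mk] := eqVneq m k; have km : k != m by rewrite eq_sym.
(* The row [e_k - e_m] annihilates [e_k + e_m], which forces equal diagonal values. *)
have := q0 (delta_mx k 0 + delta_mx m 0) (delta_mx 0 k - delta_mx 0 m).
rewrite mulmxBl !mulmxDr !mul_delta_mx !mul_delta_mx_0 // addr0 add0r subrr.
move=> /(_ erefl); rewrite (bilinDr bq) !(bilinDl bq) !(bilinNr bq).
rewrite (q0 (delta_mx m 0) (delta_mx 0 k)) ?mul_delta_mx_0 //.
rewrite (q0 (delta_mx k 0) (delta_mx 0 m)) ?mul_delta_mx_0 //.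
by rewrite addr0 oppr0 add0r => /eqP; rewrite subr_eq0 => /eqP.
Qed.

Section Householder.
Variable n : nat.
Implicit Types (a b x y : 'cV[C]_n).

Let cdot x y : C := (x ^t* *m y) 0 0.

Lemma cdotE x y : x ^t* *m y = (cdot x y)%:M.
Proof. exact: mx11_scalar. Qed.

(** Reflect along [w = a - z b]. The phase [z] is chosen so that the inner product of [z b] with [a]
    is [|c| >= 0]; then [||w||^2 = 2 (1 - |c|)] and the reflection is
    [1 - w w^dagger / (1 - |c|)]. *)
Lemma householder a b : a ^t* *m a = 1%:M -> b ^t* *m b = 1%:M ->
  exists (H : 'M[C]_n) (z : C),
    [/\ H *m H ^t* = 1%:M, z != 0, H *m a = z *: b &
      forall y, a ^t* *m y = 0 -> b ^t* *m y = 0 -> H *m y = y].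
Proof.
move=> aa bb; set c := cdot b a.
have [z [z1 zc]] : exists z, `|z| = 1 /\ z^* * c = `|c|.
  have [->|c0] := eqVneq c 0; first by exists 1; rewrite normr1 mulr0 normr0.
  exists (c / `|c|); rewrite normrM normfV normr_id divff ?normr_eq0 //; split=> //.
  rewrite rmorphM fmorphV /= (CrealP (normr_real c)) mulrAC [c^* * c]mulrC -normCK.
  by rewrite expr2 mulfK // normr_eq0.
have z0 : z != 0 by rewrite -normr_eq0 z1 oner_eq0.
have zz : z^* * z = 1 by rewrite mulrC -normCK z1 expr1n.
pose w := a - z *: b.
have wadj : w ^t* = a ^t* - z^* *: b ^t* by rewrite adjmxD adjmxN adjmxZ.
have ba : b ^t* *m a = c%:M by exact: cdotE.
have ab : a ^t* *m b = (c^*)%:M.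
  by rewrite -[RHS]/((c^*)%:M) -[a^t* *m b]trmxCK adjmxM trmxCK ba
             tr_scalar_mx map_scalar_mx.
have wa : w ^t* *m a = (1 - `|c|)%:M.
  by rewrite wadj mulmxBl aa -scalemxAl ba scale_scalar_mx zc raddfB.
have wb : w ^t* *m (z *: b) = (`|c| - 1)%:M.
  rewrite -scalemxAr wadj mulmxBl ab -scalemxAl bb !scale_scalar_mx -!raddfB.
  rewrite /= scale_scalar_mx mulrBr mulr1 [z * z^*]mulrC zz; congr (_ - _)%:M.
  by rewrite -[z in LHS]conjCK -rmorphM /= zc (CrealP (normr_real c)).
have ww : w ^t* *m w = (2 * (1 - `|c|))%:M.
  by rewrite {2}/w mulmxBr wa wb -raddfB; congr (_%:M); ring.
(* If [|c| = 1] then [w = 0], so [a = z b] already and the identity serves. *)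
have [c1|c1] := eqVneq `|c| 1.
  exists 1%:M, z; split=> [||| y _ _]; rewrite ?adjmx1 ?mul1mx //.
  apply/eqP; rewrite -subr_eq0 -/w; apply/eqP; apply: adj_mul_eq0.
  by rewrite ww c1 subrr mulr0 raddf0.
have c1' : 1 - `|c| != 0 by rewrite subr_eq0 eq_sym.
pose H : 'M[C]_n := 1%:M - (1 - `|c|)^-1 *: (w *m w ^t*).
have HC : H ^t* = H.
  have /CrealP cr : (1 - `|c|)^-1 \is Num.real.
    by rewrite realV realB ?real1 ?normr_real.
  by rewrite adjmxD adjmxN adjmx1 adjmxZ adjmxM trmxCK cr.
exists H, z; split=> // [||y ay bY].
- rewrite HC mulmxBl mul1mx mulmxBr mulmx1 -scalemxAl -scalemxAr.
  rewrite -mulmxA (mulmxA (w^t*)) ww mul_scalar_mx -scalemxAr scalerA.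
  rewrite mulrCA mulVf // mulr1 !scalerA.
  by apply/matrixP => i j; rewrite !mxE; field.
- rewrite mulmxBl mul1mx -scalemxAl -mulmxA wa mul_mx_scalar scalerA mulVf //.
  by rewrite scale1r subKr.
- have wy : w ^t* *m y = 0 by rewrite wadj mulmxBl ay -scalemxAl bY scaler0 subrr.
  by rewrite mulmxBl mul1mx -scalemxAl -mulmxA wy mulmx0 scaler0 subr0.
Qed.

End Householder.

(** The second argument stands for [U^dagger] as an independent matrix, so that a condition of
    bidegree (1,1) in [U] becomes one on a bilinear form. *)
Definition unitary_null n (L : 'M[C]_n -> 'M[C]_n -> C) : Prop :=
  bilin L /\ forall U : 'M[C]_n, U *m U ^t* = 1%:M -> L U (U ^t*) = 0.

Lemma unitary_null_conj n (L : 'M[C]_n -> 'M[C]_n -> C) (U V : 'M[C]_n) :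
  U *m U ^t* = 1%:M -> V *m V ^t* = 1%:M -> unitary_null L ->
  unitary_null (fun A B => L (U *m A *m V) (V ^t* *m B *m U ^t*)).
Proof.
move=> UU VV [bL L0]; split.
  by apply: (bilin_comp bL); exact: linear_sandwich.
move=> W WW; rewrite -mulmxA -adjmxM -adjmxM mulmxA; apply: L0.
by rewrite !adjmxM !mulmxA -(mulmxA _ V) VV mulmx1 -(mulmxA _ W) WW mulmx1.
Qed.

(* The unitaries (1 - Q) + z Q with z = 1, -1, i separate the coefficients of
   1, z and z^* in the expansion of L. *)
Lemma unitary_null_proj n (L : 'M[C]_n -> 'M[C]_n -> C) (Q : 'M[C]_n) :
  unitary_null L -> Q ^t* = Q -> Q *m Q = Q -> L Q (1%:M - Q) = 0.
Proof.
move=> [bL L0] QC QQ; set S := 1%:M - Q.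
have SC : S ^t* = S by rewrite adjmxD adjmxN adjmx1 QC.
have SQ : S *m Q = 0 by rewrite mulmxBl mul1mx QQ subrr.
have QS : Q *m S = 0 by rewrite mulmxBr mulmx1 QQ subrr.
have SS : S *m S = S by rewrite {1}/S mulmxBl mul1mx QS subr0.
have SE : S + Q = 1%:M by rewrite subrK.
clearbody S.
have E z : z * z^* = 1 ->
    L S S + L Q Q + z * L Q S + z^* * L S Q = 0.
  move=> zz; have := L0 (S + z *: Q); rewrite adjmxD adjmxZ SC QC.
  rewrite mulmxDl !mulmxDr -!scalemxAl -!scalemxAr SS SQ QS QQ scalerA zz.
  rewrite !scaler0 scale1r addr0 add0r SE => /(_ erefl).
  rewrite (bilinDl bL) !(bilinDr bL) !(bilinZl bL) !(bilinZr bL) => <-.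
  by rewrite (mulrA z) zz; ring.
have E1 := E 1; have E2 := E (-1); have E3 := E 'i.
rewrite rmorph1 mulr1 in E1; rewrite rmorphN rmorph1 mulrNN mulr1 in E2.
rewrite conjCi mulrN -expr2 sqrCi opprK in E3.
move: (E1 erefl) (E2 erefl) (E3 erefl).
move: (L S S + L Q Q) (L Q S) (L S Q) => s x y e1 e2 e3.
have s0 : s = 0.
  apply/eqP; rewrite -(mulrI_eq0 _ (mulfI (_ : 2 != 0))) ?pnatr_eq0 //.
  by rewrite -[X in _ == X](addr0 0) -{1}e1 -e2; apply/eqP; ring.
have yE : y = - x by apply/eqP; rewrite -addr_eq0 addrC -e1 s0; apply/eqP; ring.
move: e3; rewrite s0 yE add0r mulrNN -mulr2n -mulrnAr => /eqP.
by rewrite mulf_eq0 (negPf (neq0Ci _)) mulrn_eq0 /= => /eqP.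
Qed.

(** Translate by the reflection [V = 1 - 2 S]. Since [Q V = Q] and [V^dagger (1 - Q) = 1 - Q - 2 S],
    comparing [unitary_null_proj] for [L] and for its translate isolates [L Q (2 S)]. *)
Lemma unitary_null_orth_proj n (L : 'M[C]_n -> 'M[C]_n -> C) (Q S : 'M[C]_n) :
  unitary_null L -> Q ^t* = Q -> Q *m Q = Q -> S ^t* = S -> S *m S = S ->
  Q *m S = 0 -> L Q S = 0.
Proof.
move=> uL QC QQ SC SS QS; have bL := uL.1.
pose V : 'M[C]_n := 1%:M - 2 *: S.
have VC : V ^t* = V by rewrite adjmxD adjmxN adjmx1 adjmxZ SC rmorph_nat.
have VV : V *m V ^t* = 1%:M.
  rewrite VC mulmxBl mul1mx mulmxBr mulmx1 -scalemxAl -scalemxAr SS.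
  by apply/matrixP => i j; rewrite !mxE; ring.
have UU : (1%:M : 'M[C]_n) *m 1%:M ^t* = 1%:M by rewrite adjmx1 mulmx1.
have := unitary_null_proj (unitary_null_conj UU VV uL) QC QQ.
have SQ : S *m Q = 0 by rewrite -[LHS]trmxCK adjmxM QC SC QS adjmx0.
have := unitary_null_proj uL QC QQ => e1.
rewrite mul1mx adjmx1 mulmx1 VC /V mulmxBr mulmx1 -scalemxAr QS scaler0 subr0.
rewrite mulmxBr mulmx1 mulmxBl mul1mx -scalemxAl SQ scaler0 subr0.
rewrite addrAC (bilinDr bL) e1 add0r (bilinNr bL) (bilinZr bL) => /eqP.
by rewrite oppr_eq0 mulf_eq0 pnatr_eq0 /= => /eqP.
Qed.

Lemma cV_normalize n (u : 'cV[C]_n) : u != 0 ->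
  exists (a : 'cV[C]_n) (z : C), a ^t* *m a = 1%:M /\ u = z *: a.
Proof.
move=> u0; pose s : C := (u ^t* *m u) 0 0.
have sE : u ^t* *m u = s%:M by exact: mx11_scalar.
have s0 : s != 0.
  by apply: contra_neq u0 => s0; apply: adj_mul_eq0; rewrite sE s0 raddf0.
have s_ge0 : 0 <= s.
  have := mxtrace_mul_adj_ge0 (u ^t*).
  by rewrite trmxCK sE mxtrace_scalar mulr1n.
have r0 : sqrtC s != 0 by rewrite sqrtC_eq0.
exists ((sqrtC s)^-1 *: u), (sqrtC s); rewrite scalerA divff // scale1r; split=> //.
rewrite adjmxZ -scalemxAl -scalemxAr scalerA sE scale_scalar_mx; congr (_%:M).
rewrite geC0_conj ?invr_ge0 ?sqrtC_ge0 // -{3}[s]sqrtCK expr2.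
by rewrite mulrA mulfVK // mulVf.
Qed.

(** After normalization, orthogonality of [a1, a2] and of [b1, b2] permits a unitary [U] sending
    each [a_i] to a multiple of [b_i]; translating by [U] reduces the claim to the orthogonal
    projections [a1 a1^dagger] and [a2 a2^dagger]. *)
Lemma unitary_null_rank1 n (L : 'M[C]_n -> 'M[C]_n -> C)
    (u v : 'cV[C]_n) (r w : 'rV[C]_n) :
  unitary_null L -> w *m u = 0 -> r *m v = 0 -> L (u *m r) (v *m w) = 0.
Proof.
move=> uL wu rv; have bL := uL.1.
have [->|u0] := eqVneq u 0; first by rewrite mul0mx (bilin0l bL).
have [->|v0] := eqVneq v 0; first by rewrite mul0mx (bilin0r bL).
have [->|r0] := eqVneq r 0; first by rewrite mulmx0 (bilin0l bL).
have [->|w0] := eqVneq w 0; first by rewrite mulmx0 (bilin0r bL).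
have adj0 m (A : 'rV[C]_m) : A != 0 -> A ^t* != 0.
  by apply: contra_neq => A0; rewrite -[A]trmxCK A0 adjmx0.
have [b1 [z1 [b1b1 uE]]] := cV_normalize u0.
have [a1 [z2 [a1a1 rE]]] := cV_normalize (adj0 _ _ r0).
have [a2 [z3 [a2a2 vE]]] := cV_normalize v0.
have [b2 [z4 [b2b2 wE]]] := cV_normalize (adj0 _ _ w0).
have z1' : z1 != 0 by apply: contra_neq u0 => z0; rewrite uE z0 scale0r.
have z2' : z2 != 0 by apply: contra_neq (adj0 _ _ r0) => z0; rewrite rE z0 scale0r.
have z3' : z3 != 0 by apply: contra_neq v0 => z0; rewrite vE z0 scale0r.
have z4' : z4 != 0 by apply: contra_neq (adj0 _ _ w0) => z0; rewrite wE z0 scale0r.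
have {}rE : r = z2^* *: a1 ^t* by rewrite -[LHS]trmxCK rE adjmxZ.
have {}wE : w = z4^* *: b2 ^t* by rewrite -[LHS]trmxCK wE adjmxZ.
have b21 : b2 ^t* *m b1 = 0.
  move/eqP: wu; rewrite uE wE -scalemxAl -scalemxAr !scaler_eq0 conjC_eq0.
  by rewrite (negPf z4') (negPf z1') => /eqP.
have a12 : a1 ^t* *m a2 = 0.
  move/eqP: rv; rewrite vE rE -scalemxAl -scalemxAr !scaler_eq0 conjC_eq0.
  by rewrite (negPf z2') (negPf z3') => /eqP.
have [H1 [y1 [H1U y1' H1a _]]] := householder a1a1 b1b1.
have H1U' : H1 ^t* *m H1 = 1%:M by apply: mulmx1C.
have Ha2 : (H1 *m a2) ^t* *m (H1 *m a2) = 1%:M.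
  by rewrite adjmxM mulmxA -(mulmxA (a2^t*)) H1U' mulmx1.
(* The second reflection moves [H1 a2] to a multiple of [b2] and keeps [b1], which is orthogonal to
   both. *)
have [H2 [y2 [H2U y2' H2a H2y]]] := householder Ha2 b2b2.
have H2b1 : H2 *m b1 = b1.
  apply: H2y b21; rewrite -[b1](scalerK y1') -H1a -scalemxAr adjmxM.
  rewrite -mulmxA (mulmxA (H1^t*)) H1U' mul1mx -[X in _ *: X]trmxCK adjmxM trmxCK.
  by rewrite a12 adjmx0 scaler0.
pose U := H2 *m H1.
have UU : U *m U ^t* = 1%:M.
  by rewrite adjmxM mulmxA -(mulmxA H2) H1U mulmx1.
have Ua1 : b1 = y1^-1 *: (U *m a1).
  by rewrite /U -mulmxA H1a -scalemxAr H2b1 scalerK.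
have Ua2 : b2 = y2^-1 *: (U *m a2) by rewrite /U -mulmxA H2a scalerK.
have VV : (1%:M : 'M[C]_n) *m 1%:M ^t* = 1%:M by rewrite adjmx1 mulmx1.
have projC (a : 'cV[C]_n) : (a *m a ^t*) ^t* = a *m a ^t*.
  by rewrite adjmxM trmxCK.
have projK (a : 'cV[C]_n) : a ^t* *m a = 1%:M ->
    (a *m a ^t*) *m (a *m a ^t*) = a *m a ^t*.
  by move=> aa; rewrite mulmxA -(mulmxA a) aa mulmx1.
have := unitary_null_orth_proj (unitary_null_conj UU VV uL)
  (projC a1) (projK _ a1a1) (projC a2) (projK _ a2a2).
rewrite mulmxA -(mulmxA a1) a12 mulmx0 mul0mx => /(_ erefl).
rewrite mulmx1 adjmx1 mul1mx mulmxA -(mulmxA a2) -adjmxM => L0.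
rewrite uE rE vE wE Ua1 Ua2 adjmxZ -!scalemxAl -!scalemxAr -?scalemxAl.
by rewrite !(bilinZl bL) !(bilinZr bL) L0 !mulr0.
Qed.

(** Two applications of [bilin_orthogonal], first to the outer indices [k, l] and then to the inner
    [a, b], show that [L] is determined by its partial contractions. *)
Lemma unitary_null_delta n (L : 'M[C]_n -> 'M[C]_n -> C) : (0 < n)%N ->
  unitary_null L -> forall k a b l : 'I_n,
  L (delta_mx k a) (delta_mx b l) =
  n%:R^-1 * ((k == l)%:R * \sum_m L (delta_mx m a) (delta_mx b m) +
             (a == b)%:R * \sum_c L (delta_mx k c) (delta_mx c l)).
Proof.
move=> n0 uL k a b l; have bL := uL.1.
have nz : n%:R != 0 :> C by rewrite pnatr_eq0 -lt0n.
pose G (k l : 'I_n) := \sum_c L (delta_mx k c) (delta_mx c l).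
pose T := \sum_m G m m.
have dE (i j : 'I_n) : delta_mx i j = delta_mx i 0 *m delta_mx 0 j :> 'M[C]_n.
  by rewrite mul_delta_mx.
have Q1 (v : 'cV[C]_n) (r : 'rV[C]_n) : r *m v = 0 -> forall k l,
    L (delta_mx k 0 *m r) (v *m delta_mx 0 l) =
    (k == l)%:R * (n%:R^-1 * \sum_m L (delta_mx m 0 *m r) (v *m delta_mx 0 m)).
  move=> rv; apply: (bilin_orthogonal (q := fun u w => L (u *m r) (v *m w))) => //.
    by apply: (bilin_comp bL); [exact: linear_mulmxr | exact: linear_mulmxl].
  by move=> u w wu; exact: unitary_null_rank1.
(* The failure of [Q1] when [r v != 0]: a bilinear form in [(v, r)] that vanishes for [r v = 0], so
   [bilin_orthogonal] applies again. *)
pose q k l (v : 'cV[C]_n) (r : 'rV[C]_n) : C :=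
  L (delta_mx k 0 *m r) (v *m delta_mx 0 l) -
  (k == l)%:R * (n%:R^-1 * \sum_m L (delta_mx m 0 *m r) (v *m delta_mx 0 m)).
have bq k' l' : bilin (q k' l').
  have bL' (k1 l1 : 'I_n) : bilin (fun (v : 'cV[C]_n) (r : 'rV[C]_n) =>
      L (delta_mx k1 0 *m r) (v *m delta_mx 0 l1)).
    split=> [r x v v'|v x r r'].
      by rewrite mulmxDl -scalemxAl (bilinDr bL) (bilinZr bL).
    by rewrite mulmxDr -scalemxAr (bilinDl bL) (bilinZl bL).
  split=> [r x v v'|v x r r']; rewrite /q.
    rewrite (bL' k' l').1 (eq_bigr _ (fun m _ => (bL' m m).1 r x v v')).
    by rewrite big_split -mulr_sumr /=; ring.
  rewrite (bL' k' l').2 (eq_bigr _ (fun m _ => (bL' m m).2 v x r r')).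
  by rewrite big_split -mulr_sumr /=; ring.
have main k' a' b' l' : L (delta_mx k' a') (delta_mx b' l') =
    n%:R^-1 * ((k' == l')%:R * \sum_m L (delta_mx m a') (delta_mx b' m) +
             (a' == b')%:R * (G k' l' - (k' == l')%:R * (n%:R^-1 * T))).
  have q0 v r : r *m v = 0 -> q k' l' v r = 0.
    by move=> rv; rewrite /q (Q1 _ _ rv) subrr.
  have := bilin_orthogonal n0 (bq k' l') q0 b' a'.
  rewrite {1}/q -!dE.
  under eq_bigr do rewrite -!dE.
  move=> /eqP; rewrite subr_eq => /eqP ->.
  rewrite [b' == a']eq_sym /q sumrB -mulr_sumr -mulr_sumr exchange_big /=.
  under eq_bigr do rewrite -!dE.
  under [X in _ * (_ - _ * (_ * X))]eq_bigr do under eq_bigr do rewrite -!dE.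
  by rewrite -/(G k' l') -/T; ring.
(* The full contraction [T] equals [n] times [L 1 1], because [main] kills the off-diagonal terms of
   [L 1 1]; and [L 1 1 = 0] is the case [U = 1]. *)
have T0 : T = 0.
  have := uL.2 1%:M; rewrite adjmx1 mulmx1 => /(_ erefl).
  rewrite -sum_delta_diag.
  rewrite (bilin_suml bL) (eq_bigr (fun a => n%:R^-1 *
      (\sum_m L (delta_mx m a) (delta_mx a m) + (G a a - n%:R^-1 * T)))).
    rewrite -mulr_sumr big_split /= exchange_big /= sumrB sumr_const card_ord.
    rewrite -/T -[X in _ - X]mulr_natl mulrA divff // mul1r subrr addr0 => /eqP.
    by rewrite mulf_eq0 invr_eq0 (negPf nz) => /eqP.
  move=> c _; rewrite (bilin_sumr bL) (bigD1 c) //= main eqxx !mul1r.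
  rewrite [X in _ + X]big1 ?addr0 // => j jc.
  by rewrite main ![c == j]eq_sym (negPf jc) !mul0r addr0 mulr0.
by rewrite main T0 !mulr0 subr0.
Qed.

End BilinearForms.

(** * Removing the mean of the diagonal from a family of operators *)

Section TracelessFamily.
Variable C : numClosedFieldType.

(** The cross terms contribute [-2/d] and the square [+1/d] of the sandwich by [B]. This puts a
    difference of completely positive maps in Kraus form; it serves for the input built on
    [1 - Phi], for [cobell] and for [flip]. *)
Lemma sum_traceless_sandwich d m n (A : 'I_d -> 'I_d -> 'M[C]_(m, n)) (X : 'M[C]_n) :
  let B := \sum_i A i i in
  let G i j := A i j - (if i == j then d%:R^-1 *: B else 0) in
  \sum_i \sum_j G i j *m X *m (G i j) ^t* =
  \sum_i \sum_j A i j *m X *m (A i j) ^t* - d%:R^-1 *: (B *m X *m B ^t*).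
Proof.
move=> B G; case: d A @B @G => [|d] A B G.
  by rewrite !big_ord0 /B big_ord0 !mul0mx scaler0 subr0.
have d0 : d.+1%:R != 0 :> C by rewrite pnatr_eq0.
pose s : C := d.+1%:R^-1.
have sC : s^* = s by rewrite fmorphV rmorph_nat.
pose D i j := if i == j then s *: (B *m X *m (A i j)^t*) + s *: (A i j *m X *m B^t*)
                        - (s * s) *: (B *m X *m B^t*) else 0.
have GE i j : G i j *m X *m (G i j) ^t* = A i j *m X *m (A i j)^t* - D i j.
  rewrite /G /D; case: eqP => _; last by rewrite !subr0.
  rewrite adjmxD adjmxN adjmxZ -/s sC !mulmxBl !mulmxBr -!scalemxAl -!scalemxAr.
  rewrite scalerA !opprD !opprK !addrA.
  by congr (_ + _); rewrite addrAC.
under eq_bigr do under eq_bigr do rewrite GE.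
under eq_bigr do rewrite sumrB.
rewrite sumrB sum_diag; congr (_ - _).
rewrite sumrB big_split /= -!scaler_sumr -mulmx_sumr -adjmx_sum -!mulmx_suml -/B.
have ssd : s * s * d.+1%:R = s by rewrite -mulrA mulVf ?mulr1.
rewrite sumr_const card_ord -(scaler_nat _ B) -!scalemxAl scalerA ssd.
by rewrite addrK.
Qed.

End TracelessFamily.

(** * Reduction to pure states by polarization *)

Section Polarization.
Variable C : numClosedFieldType.

(** Rank-one projections span all matrices: [u + w] and [u + i w] recover [u w^dagger], and these
    include the matrix units. *)
Lemma linear_psd_eq0 n (V : lmodType C) (F : 'M[C]_n -> V) : linear F ->
  (forall v : 'cV[C]_n, v ^t* *m v = 1%:M -> F (v *m v ^t*) = 0) ->
  forall X, F X = 0.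
Proof.
move=> lF F1.
have FD X Y : F (X + Y) = F X + F Y by rewrite -{1}[X]scale1r lF scale1r.
have F0' : F 0 = 0 by apply: (addrI (F 0)); rewrite -FD !addr0.
have FZ a X : F (a *: X) = a *: F X by rewrite -[a *: X]addr0 lF F0' addr0.
have F2 (v : 'cV[C]_n) : F (v *m v ^t*) = 0.
  have [->|v0] := eqVneq v 0; first by rewrite mul0mx.
  have [a [z [aa ->]]] := cV_normalize v0.
  by rewrite adjmxZ -scalemxAl -scalemxAr !FZ F1 // !scaler0.
have F3 (u w : 'cV[C]_n) : F (u *m w ^t*) = 0.
  have E z : z^* *: F (u *m w ^t*) + z *: F (w *m u ^t*) = 0.
    have := F2 (u + z *: w); rewrite adjmxD adjmxZ mulmxDl !mulmxDr.
    rewrite -!scalemxAl -!scalemxAr !FD !FZ !F2 !scaler0 addr0 add0r.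
    by [].
  have := E 1; have := E 'i; rewrite conjCi rmorph1 !scale1r.
  set x := F _; set y := F _ => e1 e2.
  have yE : y = - x by apply/eqP; rewrite -addr_eq0 addrC e2.
  move/eqP: e1; rewrite yE scalerN scaleNr -opprD oppr_eq0 -scalerDl.
  by rewrite scaler_eq0 -mulr2n mulrn_eq0 /= (negPf (neq0Ci _)) => /eqP.
move=> X; rewrite [X]matrix_sum_delta.
rewrite (big_morph F FD F0') big1 // => i _.
rewrite (big_morph F FD F0') big1 // => j _.
rewrite FZ -(mul_delta_mx (0 : 'I_1)) -[X in _ *m X]trmxCK.
by rewrite adjmx_delta F3 scaler0.
Qed.

End Polarization.

(** * The lower bound for feasible maps *)

Section LowerBound.
Variables (R : realType) (d : nat).
Hypothesis d0 : (0 < d)%N.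
Local Notation C := R[i].

(** At [(U, U^dagger)] this is the Choi operator of the unitary channel; separating the two
    arguments makes it bilinear. *)
Definition choi2 (A B : 'M[C]_d) : 'M[C]_(d * d) :=
  \sum_i \sum_j delta_mx i j *t (A *m delta_mx i j *m B).

Lemma choi2_delta (k a b l : 'I_d) :
  choi2 (delta_mx k a) (delta_mx b l) = delta_mx a b *t delta_mx k l.
Proof.
rewrite /choi2 (bigD1 a) //= [X in _ + X]big1 => [|i ia].
  rewrite addr0 (bigD1 b) //= [X in _ + X]big1 => [|j jb].
    by rewrite addr0 !mul_delta_mx.
  by rewrite mul_delta_mx mul_delta_mx_0 // mxtens.tensmx0.
by rewrite big1 // => j _; rewrite mul_delta_mx_0 1?eq_sym // mul0mx mxtens.tensmx0.
Qed.

Lemma choi2Pl x A A' B : choi2 (x *: A + A') B = x *: choi2 A B + choi2 A' B.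
Proof.
rewrite /choi2 scaler_sumr -big_split; apply: eq_bigr => i _ /=.
rewrite scaler_sumr -big_split; apply: eq_bigr => j _ /=.
by rewrite !mulmxDl -!scalemxAl tensmxDr tensmxZr.
Qed.

Lemma choi2Pr x A B B' : choi2 A (x *: B + B') = x *: choi2 A B + choi2 A B'.
Proof.
rewrite /choi2 scaler_sumr -big_split; apply: eq_bigr => i _ /=.
rewrite scaler_sumr -big_split; apply: eq_bigr => j _ /=.
by rewrite !mulmxDr -!scalemxAr tensmxDr tensmxZr.
Qed.

(* Every unitary channel is in [AdSU]: the phase does not change the channel. *)
Lemma det_phase (U : 'M[C]_d) : U *m U ^t* = 1%:M ->
  exists z : C, z * z^* = 1 /\ \det (z *: U) = 1.
Proof.
move=> UU; have detUC : \det (U ^t*) = (\det U)^* by rewrite det_map_mx det_tr.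
have detU : \det U * (\det U)^* = 1 by rewrite -detUC -det_mulmx UU det1.
have detU0 : \det U != 0 by apply: contra_eq_neq detU => ->; rewrite mul0r eq_sym oner_eq0.
have zd : d.-root (\det U)^-1 ^+ d = (\det U)^-1 by rewrite rootCK.
exists (d.-root (\det U)^-1); split; last by rewrite detZ zd mulVf.
rewrite -normCK; apply/eqP; rewrite sqrp_eq1 //.
rewrite -(@pexpr_eq1 _ _ d) // -normrX zd -sqrp_eq1 // normCK fmorphV.
by rewrite -invfM detU invr1.
Qed.

Variable P : {linear 'M[C]_(d * (d * d)) -> 'M[C]_d}.
Hypothesis P_tp : trace_preserving P.
Hypothesis P_programs : forall (rho U : 'M[C]_d), is_state rho ->
  U *m U ^t* = 1%:M -> \det U = 1 ->
  P (rho *t (d%:R^-1 *: choi2 U (U ^t*))) = U *m rho *m U ^t*.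

Let dN0 : d%:R != 0 :> C.
Proof. by rewrite pnatr_eq0 -lt0n. Qed.

(** Polarization extends the programming condition from pure states to all matrices [rho]; the phase
    from [det_phase], which cancels in [choi2], removes the determinant condition. *)
Lemma programs_unitary (rho U : 'M[C]_d) : U *m U ^t* = 1%:M ->
  P (rho *t choi2 U (U ^t*)) = d%:R *: (U *m rho *m U ^t*).
Proof.
move=> UU; apply/eqP; rewrite -subr_eq0; apply/eqP; move: rho.
apply: linear_psd_eq0.
  move=> a X Y; rewrite tensmxDl tensmxZl linearD linearZ /= mulmxDr mulmxDl.
  rewrite -scalemxAr -scalemxAl scalerDr scalerBr opprD addrACA.
  by rewrite !scalerA [a * _]mulrC.
move=> v vv; have [z [zz detU]] := det_phase UU.
have sv : is_state (v *m v ^t*).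
  split; last by rewrite mxtrace_mulC vv mxtrace1.
  split; first by apply/hermsymmxE; rewrite adjmxM trmxCK.
  move=> w; have := mxtrace_mul_adj_ge0 (w ^t* *m v).
  by rewrite adjmxM trmxCK !mulmxA /mxtrace big_ord1.
have zU : (z *: U) *m (z *: U) ^t* = 1%:M.
  by rewrite adjmxZ -scalemxAl -scalemxAr scalerA zz scale1r.
have := P_programs sv zU detU; rewrite tensmxZr linearZ /= => PE.
rewrite adjmxZ in PE.
have cE : choi2 (z *: U) (z^* *: U^t*) = choi2 U (U^t*).
  rewrite /choi2; apply: eq_bigr => i _; apply: eq_bigr => j _.
  by rewrite -scalemxAr -!scalemxAl scalerA mulrC zz scale1r.
rewrite cE -!scalemxAl -scalemxAr scalerA zz scale1r in PE.
by rewrite -PE scalerA divff // scale1r subrr.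
Qed.

Definition defect (rho M A B : 'M[C]_d) : C :=
  \tr ((P (rho *t choi2 A B) - d%:R *: (A *m rho *m B)) *m M).

Lemma defect_unitary_null rho M : unitary_null (defect rho M).
Proof.
split; last by move=> U UU; rewrite /defect programs_unitary // subrr mul0mx linear0.
have fin (x : C) (p q u v : 'M[C]_d) :
    \tr ((x *: p + q - d%:R *: (x *: u + v)) *m M) =
    x * \tr ((p - d%:R *: u) *m M) + \tr ((q - d%:R *: v) *m M).
  rewrite -linearZ -linearD /= scalemxAl -mulmxDl scalerBr scalerDr opprD addrACA.
  by rewrite !scalerA [d%:R * x]mulrC.
split=> [B|A] x X Y; rewrite /defect ?choi2Pl ?choi2Pr tensmxDr tensmxZr.
  have -> : (x *: X + Y) *m rho *m B = x *: (X *m rho *m B) + Y *m rho *m B.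
    by rewrite !mulmxDl -!scalemxAl.
  by rewrite linearP; exact: fin.
have -> : A *m rho *m (x *: X + Y) = x *: (A *m rho *m X) + A *m rho *m Y.
  by rewrite mulmxDr -scalemxAr.
by rewrite linearP; exact: fin.
Qed.

Lemma defect_delta rho M (k a b l : 'I_d) :
  defect rho M (delta_mx k a) (delta_mx b l) =
  \tr (P (rho *t (delta_mx a b *t delta_mx k l)) *m M) - d%:R * (rho a b * M l k).
Proof.
rewrite /defect choi2_delta delta_sandwich mulmxBl linearB /= -!scalemxAl !linearZ /=.
by rewrite mxtrace_delta_mul.
Qed.

(* Up to normalization, the fidelities with [Phi_CR] of the outputs of [P] on
   the inputs [1 (x) Phi_CR] and [Phi (x) Phi_CR]. *)
Let fidI := \sum_k \sum_l \sum_a \sum_c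
  \tr (P (delta_mx a a *t (delta_mx c c *t delta_mx k l)) *m delta_mx l k).
Let fidPhi := \sum_k \sum_l \sum_a \sum_b
  \tr (P (delta_mx a b *t (delta_mx a b *t delta_mx k l)) *m delta_mx l k).

(** [unitary_null_delta] is applied to the defect at [rho = E_ab], [M = E_lk] and summed over all
    indices. One partial contraction is fixed by trace preservation, the other is [fidI] up to a
    constant, and the left-hand side is [fidPhi] up to constants. *)
Lemma fidelity_identity : d%:R * fidPhi - fidI = d%:R ^+ 2 * (d%:R ^+ 2 - 1) ^+ 2.
Proof.
have cst (x : C) : \sum_(i < d) x = d%:R * x by rewrite sumr_const card_ord mulr_natl.
(* Summing the tests [E_jj] gives [M = 1], where trace preservation evaluates [P]. *)
have tr1 rho (k a b l : 'I_d) : \sum_j defect rho (delta_mx j j) (delta_mx k a) (delta_mx b l) =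
    \tr rho * (a == b)%:R * (k == l)%:R - d%:R * (rho a b * (l == k)%:R).
  have -> : \sum_j defect rho (delta_mx j j) (delta_mx k a) (delta_mx b l) =
      defect rho 1%:M (delta_mx k a) (delta_mx b l).
    by rewrite /defect -linear_sum -mulmx_sumr sum_delta_diag.
  by rewrite defect_delta mulmx1 P_tp !mxtrace_tens !mxtrace_delta !mxE mulrA.
have E k l a b : d%:R * (\tr (P (delta_mx a b *t (delta_mx a b *t delta_mx k l)) *m
      delta_mx l k) - d%:R) =
    (if k == l then
       \sum_m defect (delta_mx a b) (delta_mx k k) (delta_mx m a) (delta_mx b m) else 0) +
    (if a == b then
       \sum_c defect (delta_mx a a) (delta_mx l k) (delta_mx k c) (delta_mx c l) else 0).
  have := unitary_null_delta d0 (defect_unitary_null (delta_mx a b) (delta_mx l k)) k a b l.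
  rewrite [LHS]defect_delta !mxE !eqxx !mulr1 => ->; rewrite mulVKf //.
  by congr (_ + _); [case: (eqVneq k l) => [<-|]|case: (eqVneq a b) => [<-|]];
    rewrite ?mul1r ?mul0r.
(* The constant [d^5] collects the target term [d] over [d^4] index tuples; [d^2 - d^4] is the
   contraction fixed by trace preservation, the last bracket the one giving [fidI]. *)
have S : d%:R * (fidPhi - d%:R ^+ 5) = d%:R ^+ 2 - d%:R ^+ 4 + (fidI - d%:R ^+ 4).
  transitivity (\sum_k \sum_l \sum_a \sum_b
    d%:R * (\tr (P (delta_mx a b *t (delta_mx a b *t delta_mx k l)) *m delta_mx l k) - d%:R)).
    under [RHS]eq_bigr do under eq_bigr do under eq_bigr do rewrite -mulr_sumr sumrB cst.
    under [RHS]eq_bigr do under eq_bigr do rewrite -mulr_sumr sumrB cst.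
    under [RHS]eq_bigr do rewrite -mulr_sumr sumrB cst.
    by rewrite -mulr_sumr sumrB cst; congr (_ * (_ - _)); ring.
  under eq_bigr do under eq_bigr do under eq_bigr do under eq_bigr do rewrite E.
  under eq_bigr do under eq_bigr do under eq_bigr do rewrite big_split /=.
  under eq_bigr do under eq_bigr do rewrite big_split /=.
  under eq_bigr do rewrite big_split /=.
  rewrite big_split /=; congr (_ + _).
  - rewrite (eq_bigr (fun k => \sum_l if k == l then \sum_a \sum_b \sum_m
        defect (delta_mx a b) (delta_mx k k) (delta_mx m a) (delta_mx b m) else 0)).
      rewrite sum_diag exchange_big /=.
      under eq_bigr do rewrite exchange_big /=.
      under eq_bigr do under eq_bigr do rewrite exchange_big /=.
      under eq_bigr do under eq_bigr do under eq_bigr do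
        rewrite tr1 mxtrace_delta !mxE !eqxx !mulr1.
      under eq_bigr do under eq_bigr do rewrite cst.
      under eq_bigr do rewrite -mulr_sumr sumrB cst.
      rewrite -mulr_sumr sumrB cst (eq_bigr (fun=> 1)) => [|a _].
        by rewrite cst; ring.
      rewrite (bigD1 a) //= eqxx mulr1 big1 ?addr0 // => b ba.
      by rewrite eq_sym (negPf ba) mul0r.
    move=> k _; apply: eq_bigr => l _; case: eqP => // _.
    by rewrite big1 // => a _; rewrite big1.
  - under eq_bigr do under eq_bigr do rewrite sum_diag.
    under eq_bigr do under eq_bigr do under eq_bigr do under eq_bigr do
      rewrite defect_delta.
    under eq_bigr do under eq_bigr do under eq_bigr do rewrite sumrB.
    under eq_bigr do under eq_bigr do rewrite sumrB.
    under eq_bigr do rewrite sumrB.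
    rewrite sumrB -/fidI; congr (_ - _).
    rewrite (eq_bigr (fun=> d%:R ^+ 3)) => [|k _]; first by rewrite cst; ring.
    rewrite (eq_bigr (fun=> d%:R ^+ 2)) => [|l _]; first by rewrite cst; ring.
    rewrite (eq_bigr (fun=> d%:R)) => [|a _]; first by rewrite cst; ring.
    rewrite (bigD1 a) //= !mxE !eqxx big1 ?addr0 ?mulr1 // => c ca.
    by rewrite !mxE (negPf ca) mul0r mulr0.
have -> : d%:R * fidPhi = d%:R * (fidPhi - d%:R ^+ 5) + d%:R ^+ 6 by ring.
by rewrite S; ring.
Qed.

Lemma linear_id_tens r : linear (@id_tens _ r _ _ P).
Proof.
move=> x X Y; rewrite /id_tens scaler_sumr -big_split; apply: eq_bigr => i _ /=.
rewrite scaler_sumr -big_split; apply: eq_bigr => j _ /=.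
rewrite -tensmxZr -tensmxDr -linearZ -linearD; congr (_ *t P _).
by apply/matrixP => k l; rewrite !mxE.
Qed.

Lemma id_tensD r (X Y : 'M[C]_(r * (d * (d * d)))) :
  id_tens P (X + Y) = id_tens P X + id_tens P Y.
Proof. by rewrite -{1}[X]scale1r linear_id_tens scale1r. Qed.

Lemma id_tens0 r : id_tens P (0 : 'M[C]_(r * (d * (d * d)))) = 0.
Proof. by apply: (addrI (id_tens P 0)); rewrite -id_tensD !addr0. Qed.

Lemma id_tensZ r x (X : 'M[C]_(r * (d * (d * d)))) :
  id_tens P (x *: X) = x *: id_tens P X.
Proof. by rewrite -[x *: X]addr0 linear_id_tens id_tens0 addr0. Qed.

Lemma id_tens_sum r (I : Type) (s : seq I) (G : I -> 'M[C]_(r * (d * (d * d)))) :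
  id_tens P (\sum_(i <- s) G i) = \sum_(i <- s) id_tens P (G i).
Proof. exact: (big_morph _ (@id_tensD r) (id_tens0 r)). Qed.

(** Unnormalized: [Phi / d] is the projection onto the maximally entangled vector, whence the
    factors [d] below. *)
Let Phi : 'M[C]_(d * d) := \sum_i \sum_j delta_mx i j *t delta_mx i j.

Lemma mxtrace_Phi_mul (k l : 'I_d) (B : 'M[C]_d) :
  \tr (Phi *m (delta_mx k l *t B)) = \tr (B *m delta_mx l k).
Proof.
rewrite mxtrace_mulC mulmx_sumr linear_sum /= (bigD1 l) //=.
rewrite [X in _ + X]big1 => [|i il]; last first.
  rewrite mulmx_sumr linear_sum big1 //= => j _.
  by rewrite mxtens.tensmx_mul mul_delta_mx_0 1?eq_sym // mxtens.tens0mx linear0.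
rewrite addr0 mulmx_sumr linear_sum /= (bigD1 k) //= big1 => [|j jk].
  by rewrite addr0 mxtens.tensmx_mul mxtrace_tens mul_delta_mx mxtrace_delta eqxx mul1r.
rewrite mxtens.tensmx_mul mxtrace_tens mul_delta_mx mxtrace_delta eq_sym.
by rewrite (negPf jk) mul0r.
Qed.

Lemma Phi_adj : Phi ^t* = Phi.
Proof.
rewrite adjmx_sum; under eq_bigr do rewrite adjmx_sum.
rewrite exchange_big; apply: eq_bigr => i _; apply: eq_bigr => j _.
by rewrite adjmx_tens adjmx_delta.
Qed.

Lemma Phi_sqr : Phi *m Phi = d%:R *: Phi.
Proof.
rewrite {1}/Phi mulmx_suml scaler_sumr; apply: eq_bigr => i _.
rewrite mulmx_suml (eq_bigr (fun=> \sum_l delta_mx i l *t delta_mx i l)) => [|j _].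
  by rewrite sumr_const card_ord scaler_nat.
rewrite mulmx_sumr (bigD1 j) //= [X in _ + X]big1 ?addr0 => [|k kj].
  by rewrite mulmx_sumr; apply: eq_bigr => l _; rewrite mxtens.tensmx_mul !mul_delta_mx.
rewrite mulmx_sumr big1 // => l _.
by rewrite mxtens.tensmx_mul mul_delta_mx_0 1?eq_sym // mxtens.tens0mx.
Qed.

Let ket (k : 'I_d) : 'cV[C]_d := delta_mx k 0.
(** Tensor factors in the order reference [R], input [A], program halves [B], [C]: [F p q] is
    [|p>|q>] on [AB] times the unnormalized maximally entangled vector of [RC], and [g] entangles
    [AB] in the same way. *)
Let F p q := \sum_k ket k *t (ket p *t (ket q *t ket k)).
Let g := \sum_a F a a.

Lemma F_mul_adj p q p' q' : F p q *m (F p' q') ^t* =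
  \sum_k \sum_l delta_mx k l *t (delta_mx p p' *t (delta_mx q q' *t delta_mx k l)).
Proof.
rewrite mulmx_suml; apply: eq_bigr => k _; rewrite adjmx_sum mulmx_sumr.
apply: eq_bigr => l _; rewrite !adjmx_tens !mxtens.tensmx_mul !adjmx_delta.
by rewrite !mul_delta_mx.
Qed.

Lemma mxtrace_F_mul_adj p q p' q' :
  \tr (F p q *m (F p' q') ^t*) = d%:R * (p == p')%:R * (q == q')%:R.
Proof.
rewrite F_mul_adj linear_sum /= (eq_bigr (fun=> (p == p')%:R * (q == q')%:R)) => [|k _].
  by rewrite sumr_const card_ord -[LHS]mulr_natl mulrA.
rewrite linear_sum /= (bigD1 k) //= big1 => [|l lk].
  by rewrite !mxtrace_tens !mxtrace_delta eqxx mul1r mulr1 addr0.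
by rewrite mxtrace_tens mxtrace_delta eq_sym (negPf lk) mul0r.
Qed.

Lemma mxtrace_Phi_F p q p' q' :
  \tr (Phi *m id_tens P (F p q *m (F p' q') ^t*)) =
  \sum_k \sum_l \tr (P (delta_mx p p' *t (delta_mx q q' *t delta_mx k l)) *m delta_mx l k).
Proof.
rewrite F_mul_adj id_tensE mulmx_sumr linear_sum; apply: eq_bigr => k _ /=.
by rewrite mulmx_sumr linear_sum; apply: eq_bigr => l _ /=; exact: mxtrace_Phi_mul.
Qed.

Lemma g_mul_adj : g *m g ^t* = \sum_a \sum_b F a a *m (F b b) ^t*.
Proof.
by rewrite mulmx_suml; apply: eq_bigr => a _; rewrite adjmx_sum mulmx_sumr.
Qed.

Lemma mxtrace_g_mul_adj : \tr (g *m g ^t*) = d%:R ^+ 2.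
Proof.
rewrite g_mul_adj linear_sum (eq_bigr (fun=> d%:R)) => [|a _] /=.
  by rewrite sumr_const card_ord -[LHS]mulr_natl expr2.
rewrite linear_sum (bigD1 a) //= big1 => [|b ba].
  by rewrite mxtrace_F_mul_adj eqxx !mulr1 addr0.
by rewrite mxtrace_F_mul_adj eq_sym (negPf ba) mulr0.
Qed.

Lemma mxtrace_Phi_g : \tr (Phi *m id_tens P (g *m g ^t*)) = fidPhi.
Proof.
rewrite g_mul_adj id_tens_sum mulmx_sumr linear_sum /=.
under eq_bigr do rewrite id_tens_sum mulmx_sumr linear_sum /=.
under eq_bigr do under eq_bigr do rewrite mxtrace_Phi_F.
under eq_bigr do rewrite exchange_big /=.
rewrite exchange_big; apply: eq_bigr => k _ /=.
under eq_bigr do rewrite exchange_big /=.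
by rewrite exchange_big.
Qed.

Let S := \sum_p \sum_q F p q *m (F p q) ^t*.

Lemma mxtrace_S : \tr S = d%:R ^+ 3.
Proof.
rewrite linear_sum (eq_bigr (fun=> d%:R ^+ 2)) => [|p _] /=.
  by rewrite sumr_const card_ord -[LHS]mulr_natl exprS.
rewrite linear_sum (eq_bigr (fun=> d%:R)) => [|q _] /=.
  by rewrite sumr_const card_ord -[LHS]mulr_natl expr2.
by rewrite mxtrace_F_mul_adj !eqxx !mulr1.
Qed.

Lemma mxtrace_Phi_S : \tr (Phi *m id_tens P S) = fidI.
Proof.
rewrite id_tens_sum mulmx_sumr linear_sum /=.
under eq_bigr do rewrite id_tens_sum mulmx_sumr linear_sum /=.
under eq_bigr do under eq_bigr do rewrite mxtrace_Phi_F.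
under eq_bigr do rewrite exchange_big /=.
rewrite exchange_big; apply: eq_bigr => k _ /=.
under eq_bigr do rewrite exchange_big /=.
by rewrite exchange_big.
Qed.

Lemma trace_norm_scale_sum_le1 (I : Type) (s : seq I) n p (A : I -> 'M[C]_(n, p)) c X :
  0 <= c -> X = c *: \sum_(i <- s) A i *m (A i) ^t* -> \tr X = 1 ->
  trace_norm X <= 1.
Proof.
move=> c0 XE trX; rewrite -lecR -[leRHS]trX.
have -> : X = \sum_(i <- s) (sqrtC c *: A i) *m (sqrtC c *: A i) ^t*.
  rewrite XE scaler_sumr; apply: eq_bigr => i _.
  rewrite adjmxZ -scalemxAl -scalemxAr scalerA geC0_conj ?sqrtC_ge0 //.
  by rewrite -expr2 sqrtCK.
exact: trace_norm_sum_adj_le.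
Qed.

Lemma diamond_norm_ge_of_programs : (1 < d)%N ->
  ((d%:R ^+ 2 - 1)%:E <= diamond_norm P)%E.
Proof.
move=> d1; pose m : C := d%:R ^+ 2 - 1.
have m0 : 0 < m by rewrite subr_gt0 exprn_egt1 // ltr1n.
have mN0 : m != 0 by rewrite gt_eqF.
(* [X1] and [X2] are Phi (x) Phi_CR and (1 - Phi)/m (x) Phi_CR, with R first. *)
pose X1 := d%:R ^- 2 *: (g *m g ^t*).
(* [S] has trace [d^3] and the subtracted part has trace [d], so [1 / (d m)] normalizes the
   difference. *)
pose c := (d%:R * m)^-1.
pose X2 := c *: (S + (- d%:R^-1) *: (g *m g ^t*)).
have tr1 : \tr X1 = 1 by rewrite linearZ /= mxtrace_g_mul_adj mulVf // expf_neq0.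
have tr2 : \tr X2 = 1.
  rewrite linearZ /= linearD linearZ /= mxtrace_S mxtrace_g_mul_adj /c /m.
  by field; rewrite dN0 mN0.
have n1 : trace_norm X1 <= 1.
  apply: (trace_norm_scale_sum_le1 (s := [:: tt]) (A := fun=> g) _ _ tr1); last first.
    by rewrite big_seq1.
  by rewrite invr_ge0 exprn_ge0.
have n2 : trace_norm X2 <= 1.
  (* [X2] is positive: removing the component along [g] from the family [F] writes it as a multiple
     of a sum of terms [psi psi^dagger]. *)
  pose psi i j := F i j - (if i == j then d%:R^-1 *: g else 0).
  apply: (trace_norm_scale_sum_le1 (s := index_enum _) (c := c)
    (A := fun i : 'I_d * 'I_d => psi i.1 i.2) _ _ tr2).
    by rewrite invr_ge0 mulr_ge0 // ltW.
  rewrite /X2; congr (_ *: _); rewrite -(pair_bigA _ (fun i j => psi i j *m (psi i j)^t*)) /=.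
  have E := sum_traceless_sandwich F 1%:M.
  transitivity (\sum_i \sum_j psi i j *m 1%:M *m (psi i j)^t*).
    rewrite E mulmx1 scaleNr; congr (_ - _).
    by apply: eq_bigr => i _; apply: eq_bigr => j _; rewrite mulmx1.
  by apply: eq_bigr => i _; apply: eq_bigr => j _; rewrite mulmx1.
(* A reflection, so [W] and [- W] are both admissible tests for the trace norm. *)
pose W : 'M[C]_(d * d) := (2 / d%:R) *: Phi - 1%:M.
have WC : W ^t* = W.
  rewrite adjmxD adjmxN adjmx1 adjmxZ Phi_adj rmorphM fmorphV !rmorph_nat //.
have WW : W *m W ^t* = 1%:M.
  rewrite WC mulmxBl mul1mx mulmxBr mulmx1 -scalemxAl -scalemxAr Phi_sqr !scalerA.
  by apply/matrixP => i j; rewrite !mxE; field.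
have NWW : (- W) *m (- W) ^t* = 1%:M by rewrite adjmxN mulNmx mulmxN opprK.
have trW X : \tr (W *m id_tens P X) = 2 / d%:R * \tr (Phi *m id_tens P X) - \tr X.
  rewrite mulmxBl mul1mx -scalemxAl linearB linearZ /=; congr (_ - _).
  by rewrite (mxtrace_id_tens (c := 1)) ?mul1r // => Y; rewrite mul1r P_tp.
have tP1 : \tr (Phi *m id_tens P X1) = d%:R ^- 2 * fidPhi.
  by rewrite /X1 id_tensZ -scalemxAr mxtraceZ mxtrace_Phi_g.
have tP2 : \tr (Phi *m id_tens P X2) = c * (fidI - d%:R^-1 * fidPhi).
  rewrite /X2 id_tensZ -scalemxAr mxtraceZ id_tensD id_tensZ mulmxDr mxtraceD.
  by rewrite -scalemxAr mxtraceZ mxtrace_Phi_S mxtrace_Phi_g mulNr.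
have fidIE : fidI = d%:R * fidPhi - d%:R ^+ 2 * m ^+ 2.
  by rewrite -fidelity_identity; ring.
clearbody X1 X2 fidI fidPhi.
(* [fidIE] eliminates [fidI], after which the unknown [fidPhi] cancels and only [2 m] remains. *)
have diff : \tr (W *m id_tens P X1) + \tr (- W *m id_tens P X2) = 2 * m.
  rewrite mulNmx [\tr (- _)]linearN /= !trW tr1 tr2 tP1 tP2 fidIE /c /m.
  by field; rewrite dN0 mN0.
have b1 := trace_norm_ge_isometry (id_tens P X1) WW.
have b2 := trace_norm_ge_isometry (id_tens P X2) NWW.
have := lerD b1 b2; rewrite addrACA -rmorphD diff.
pose mR : R := d%:R ^+ 2 - 1.
have mE : 2 * m = (2 * mR)%:C%C.
  by rewrite /m /mR rmorphM /= rmorphB /= rmorphXn /= !rmorph_nat ?rmorph1.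
have mC : (2 * m)^* = 2 * m.
  by rewrite geC0_conj // mulr_ge0 // ltW.
rewrite [X in _ + X <= _]mC mE -!rmorphD lecR => sum_ge.
have ub (X : 'M[C]_(d * (d * (d * d)))) : trace_norm X <= 1 ->
    ((trace_norm (id_tens P X))%:E <= diamond_norm P)%E.
  by move=> X1'; apply: ereal_sup_ubound; exists d, X.
(* Two norms with sum at least [2 m] cannot both lie below [m]. *)
have [h|h] := leP mR (trace_norm (id_tens P X1)).
  by apply: le_trans (ub _ n1); rewrite lee_fin.
apply: le_trans (ub _ n2); rewrite lee_fin -/mR.
rewrite leNgt; apply/negP => h2.
have := ltrD h h2; rewrite -subr_gt0 => h3; move: sum_ge.
by rewrite -mulrnDl -[leRHS]mulr_natl -mulrDr ler_pM2l ?ltr0n // -subr_ge0 leNgt -opprB oppr_lt0 h3.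
Qed.

End LowerBound.

(** * A program attaining the lower bound *)

Section OptimalProgram.
Variables (R : realType) (d : nat).
Hypothesis d1 : (1 < d)%N.
Local Notation C := R[i].

Let m : C := d%:R ^+ 2 - 1.

Let dN0 : d%:R != 0 :> C.
Proof. by rewrite pnatr_eq0 -lt0n ltnW. Qed.

Let m_gt0 : 0 < m.
Proof. by rewrite subr_gt0 exprn_egt1 // ltr1n. Qed.

Let mN0 : m != 0.
Proof. by rewrite gt_eqF. Qed.

Let ix (p q k : 'I_d) : 'I_(d * (d * d)) :=
  mxtens.mxtens_index (p, mxtens.mxtens_index (q, k)).

(* The operator <p|<q| (x) 1. *)
Let K p q : 'M[C]_(d, d * (d * d)) := \matrix_(k, s) (s == ix p q k)%:R.

Lemma K_sandwichE p q p' q' X k l :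
  (K p q *m X *m (K p' q') ^t*) k l = X (ix p q k) (ix p' q' l).
Proof.
rewrite mxE (bigD1 (ix p' q' l)) //= [X in _ + X]big1 => [|s sl]; last first.
  by rewrite !mxE (negPf sl) rmorph0 mulr0.
rewrite !mxE eqxx rmorph1 mulr1 addr0 (bigD1 (ix p q k)) //=.
rewrite [X in _ + X]big1 => [|s sl]; last by rewrite mxE (negPf sl) mul0r.
by rewrite mxE eqxx mul1r addr0.
Qed.

Lemma K_sandwich_tens p q p' q' A (B : 'M[C]_(d * d)) :
  K p q *m (A *t B) *m (K p' q') ^t* = A p p' *: mxtens_block B q q'.
Proof.
by apply/matrixP => k l; rewrite K_sandwichE mxtens.tensmxE !mxE.
Qed.

Lemma mxtrace_sum_K X : \tr (\sum_p \sum_q K p q *m X *m (K p q) ^t*) = \tr X.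
Proof.
rewrite [RHS]/mxtrace sum_mxtens_index linear_sum; apply: eq_bigr => p _ /=.
rewrite sum_mxtens_index linear_sum; apply: eq_bigr => q _ /=.
by apply: eq_bigr => k _; rewrite K_sandwichE.
Qed.

Let bell X : 'M[C]_d :=
  d%:R^-1 *: ((\sum_p K p p) *m X *m (\sum_p K p p) ^t*).

(** Kraus operators for the outcome [1 - Phi]: the family [K] with its component along the entangled
    vector removed. *)
Let coK p q := K p q - (if p == q then d%:R^-1 *: \sum_p K p p else 0).
Let cobell X := \sum_p \sum_q coK p q *m X *m (coK p q) ^t*.

(** The same correction on matrix units makes [flip] a Kraus map by construction. [flip] is also the
    uniform mixture of the conjugations by the [d^2 - 1] nontrivial Weyl unitaries. *)
Let coE (i j : 'I_d) : 'M[C]_d :=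
  delta_mx i j - (if i == j then d%:R^-1 *: \sum_k delta_mx k k else 0).
Let flip X := (d%:R / m) *: (\sum_i \sum_j coE i j *m X *m (coE i j) ^t*).

Lemma cobellE X :
  cobell X = \sum_p \sum_q K p q *m X *m (K p q) ^t* - bell X.
Proof. exact: sum_traceless_sandwich. Qed.

Lemma flipE X : flip X = (d%:R / m) *: (\tr X *: 1%:M - d%:R^-1 *: X).
Proof.
rewrite /flip sum_traceless_sandwich sum_delta_diag adjmx1 mul1mx mulmx1.
congr (_ *: (_ - _)); rewrite exchange_big -sum_delta_diag scaler_sumr.
under eq_bigr do under eq_bigr do rewrite adjmx_delta delta_sandwich.
rewrite exchange_big; apply: eq_bigr => i _ /=.
by rewrite -scaler_suml.
Qed.

Lemma mxtrace_flip X : \tr (flip X) = \tr X.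
Proof.
rewrite flipE mxtraceZ mxtraceD mxtraceZ mxtrace1 linearN /= mxtraceZ.
by have m0 := mN0; rewrite /m in m0 *; field; rewrite dN0 m0.
Qed.

Lemma mxtrace_bellD X : \tr (bell X) + \tr (cobell X) = \tr X.
Proof. by rewrite cobellE linearB /= mxtrace_sum_K addrC subrK. Qed.

Lemma kraus_bell : kraus bell.
Proof.
apply: krausZ; first by rewrite invr_ge0.
exact: kraus_sandwich.
Qed.

Lemma kraus_cobell : kraus cobell.
Proof. by apply: kraus_sum => p; apply: kraus_sum => q; exact: kraus_sandwich. Qed.

Lemma kraus_flip : kraus flip.
Proof.
apply: krausZ; first by rewrite divr_ge0 // ltW.
by apply: kraus_sum => p; apply: kraus_sum => q; exact: kraus_sandwich.
Qed.

(** The two weights differ by 1, for trace preservation, and add up to [d^2 - 1], the diamond norm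
    bound. *)
Let plus X := (d%:R ^+ 2 / 2) *: (bell X + flip (cobell X)).
Let minus X := ((d%:R ^+ 2 - 2) / 2) *: (flip (bell X) + cobell X).

Lemma kraus_plus : kraus plus.
Proof.
apply: krausZ; first by rewrite divr_ge0 // exprn_ge0.
apply: krausD kraus_bell _; exact: kraus_comp kraus_cobell kraus_flip.
Qed.

Lemma kraus_minus : kraus minus.
Proof.
apply: krausZ.
  rewrite divr_ge0 // subr_ge0 -natrX ler_nat.
  by rewrite (leq_trans _ (leq_pexp2l _ (_ : (1 <= 2)%N))) ?expn1 // ltnW.
apply: krausD kraus_cobell; exact: kraus_comp kraus_bell kraus_flip.
Qed.

Lemma mxtrace_plus X : \tr (plus X) = d%:R ^+ 2 / 2 * \tr X.
Proof. by rewrite mxtraceZ mxtraceD mxtrace_flip mxtrace_bellD. Qed.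

Lemma mxtrace_minus X : \tr (minus X) = (d%:R ^+ 2 - 2) / 2 * \tr X.
Proof. by rewrite mxtraceZ mxtraceD mxtrace_flip mxtrace_bellD. Qed.

Definition optimal_program X : 'M[C]_d := plus X - minus X.

Fact optimal_program_linear : linear optimal_program.
Proof.
move=> a X Y; rewrite /optimal_program (kraus_linear kraus_plus).
by rewrite (kraus_linear kraus_minus) scalerBr opprD addrACA.
Qed.

HB.instance Definition _ := GRing.isLinear.Build C _ _ *:%R optimal_program
  optimal_program_linear.

Lemma optimal_program_hp : hermiticity_preserving optimal_program.
Proof.
move=> X /hermsymmxE XC; apply/hermsymmxE.
by rewrite adjmxD adjmxN -(kraus_adj _ kraus_plus) -(kraus_adj _ kraus_minus) XC.
Qed.

Lemma optimal_program_tp : trace_preserving optimal_program.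
Proof.
move=> X; rewrite linearB /= mxtrace_plus mxtrace_minus.
by field.
Qed.

Definition optimal_hptp : hptp R (d * (d * d)) d :=
  Hptp optimal_program_hp optimal_program_tp.

Lemma diamond_norm_optimal : (diamond_norm optimal_hptp <= (d%:R ^+ 2 - 1)%:E)%E.
Proof.
apply: diamond_norm_kraus_diff kraus_plus kraus_minus _ => [|X].
  by rewrite subr_ge0 exprn_ege1 // ler1n ltnW.
rewrite mxtrace_plus mxtrace_minus rmorphB rmorphXn !rmorph_nat /=.
by field.
Qed.

Lemma optimal_programs (U : 'M[C]_d) (rho : 'M[C]_d) : U *m U ^t* = 1%:M ->
  \tr rho = 1 ->
  optimal_program (rho *t program_state (adU U)) = U *m rho *m U ^t*.
Proof.
move=> UU rho1; set X := rho *t _; set Y := U *m rho *m U ^t*.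
have UU' : U ^t* *m U = 1%:M by apply: mulmx1C.
have KX p q p' q' : K p q *m X *m (K p' q') ^t* =
    (d%:R^-1 * rho p p') *: (U *m delta_mx q q' *m U ^t*).
  rewrite /X /program_state tensmxZr -scalemxAr -scalemxAl K_sandwich_tens.
  by rewrite mxtens_block_sum scalerA.
(* Projecting [AB] onto the maximally entangled vector teleports [rho] through [U], with probability
   [d^-2]. *)
have bX : bell X = d%:R ^- 2 *: Y.
  rewrite /bell mulmx_suml adjmx_sum mulmx_suml.
  under eq_bigr do rewrite mulmx_sumr.
  under eq_bigr do under eq_bigr do rewrite KX -scalerA.
  under eq_bigr do rewrite -scaler_sumr.
  rewrite -scaler_sumr scalerA -invfM -expr2; congr (_ *: _).
  rewrite /Y {2}[rho]matrix_sum_delta mulmx_sumr mulmx_suml.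
  apply: eq_bigr => p _; rewrite mulmx_sumr mulmx_suml; apply: eq_bigr => q _.
  by rewrite -scalemxAr -scalemxAl.
(* Discarding [AB] leaves the output half of the program, which is maximally mixed. *)
have sX : \sum_p \sum_q K p q *m X *m (K p q) ^t* = d%:R^-1 *: 1%:M.
  under eq_bigr do under eq_bigr do rewrite KX.
  under eq_bigr do rewrite -scaler_sumr -mulmx_suml -mulmx_sumr sum_delta_diag mulmx1 UU.
  by rewrite -scaler_suml -mulr_sumr -[\sum_i _]/(\tr rho) rho1 mulr1.
have trY : \tr Y = 1 by rewrite /Y mxtrace_mulC mulmxA UU' mul1mx.
clearbody X Y.
rewrite /optimal_program /plus /minus !flipE cobellE sX bX.
rewrite !mxtraceD ![\tr (- _)]linearN /= !mxtraceZ mxtrace1 trY.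
apply/matrixP => i j; rewrite !mxE; move: (Y i j) ((i == j)%:R : C) => y e.
have m0 := mN0; rewrite /m in m0 *; field.
by rewrite dN0 m0.
Qed.

End OptimalProgram.

(** * Value and attainment from the two bounds *)

Unset Implicit Arguments.

Theorem proposition3 (R : realType) (d : nat) (hd : (2 <= d)%N) :
  nu1 (AdSU R d) = (d%:R ^+ 2 - 1)%:E
  /\ nu1_values (AdSU R d) (nu1 (AdSU R d)).
Proof.
have lower (P : hptp R (d * (d * d)) d) : programs P (AdSU R d) ->
    ((d%:R ^+ 2 - 1)%:E <= diamond_norm P)%E.
  move=> prP; apply: diamond_norm_ge_of_programs => //.
  - exact: ltnW.
  - exact: hptp_tp.
  - move=> rho U srho /unitarymxP UU detU.
    exact: (prP rho (unitary_channel UU) srho (ex_intro _ U (ex_intro _ UU (conj detU erefl)))).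
have opt : programs (optimal_hptp R hd) (AdSU R d).
  move=> rho _ [_ rho1] [U [UU [_ ->]]].
  by apply: optimal_programs => //; exact/unitarymxP.
have optE : diamond_norm (optimal_hptp R hd) = (d%:R ^+ 2 - 1)%:E.
  by apply/eqP; rewrite eq_le lower // diamond_norm_optimal.
have mem : nu1_values (AdSU R d) (d%:R ^+ 2 - 1)%:E.
  by rewrite -optE; exists (optimal_hptp R hd).
(* Attainment is [mem] once the value is known; [mem] also bounds the infimum from above. *)
suff nuE : nu1 (AdSU R d) = (d%:R ^+ 2 - 1)%:E by rewrite nuE.
apply/eqP; rewrite eq_le; apply/andP; split; first exact: ereal_inf_lbound.
by apply: le_ereal_inf_tmp => _ [P prP <-]; exact: lower.
Qed.
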